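(* Let $(E,\circ,\rho,\langle\cdot,\cdot\rangle)$ be a Courant algebroid over $M$ with associated symmetric Lie $2$-algebra structure $\mu=l_1+l_2+l_3$ on the graded vector space $V=\mathcal C^\infty(M)\oplus\Gamma(E)$. Let $N$ be a $(1,1)$-tensor on $E$ whose Nijenhuis torsion with respect to $\circ$ vanishes and which satisfies $$N+N^*=\lambda\,\mathrm{Id}_{\Gamma(E)},\qquad N^2+(N^2)^*=\gamma\,\mathrm{Id}_{\Gamma(E)},$$ with $\lambda,\gamma\in\mathcal C^\infty(M)$ Casimir functions. Define vector valued $1$-forms $\mathcal N,\mathcal K$ on $V$ by $$\mathcal N|_{\Gamma(E)}=N,\quad \mathcal N|_{\mathcal C^\infty(M)}=\lambda\,\mathrm{Id}_{\mathcal C^\infty(M)},\qquad \mathcal K|_{\Gamma(E)}=N^2=\lambda N+\tfrac{\gamma-\lambda^2}{2}\mathrm{Id}_{\Gamma(E)},\quad \mathcal K|_{\mathcal C^\infty(M)}=\gamma\,\mathrm{Id}_{\mathcal C^\infty(M)}.$$ Then $\mathcal N$ is a Nijenhuis vector valued $1$-form with respect to $\mu$, with square $\mathcal K$.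
   Context: A Courant algebroid is a vector bundle $E\to M$ with a non-degenerate (fiberwise symmetric) inner product $\langle\cdot,\cdot\rangle$, a vector bundle morphism $\rho:E\to TM$ and a bilinear operation $\circ$ on $\Gamma(E)$ such that for all $X,Y,Z\in\Gamma(E)$: (i) $X\circ(Y\circ Z)=(X\circ Y)\circ Z+Y\circ(X\circ Z)$; (ii) $\rho(X)\langle Y,Z\rangle=\langle X\circ Y,Z\rangle+\langle Y,X\circ Z\rangle$; (iii) $\rho(X)\langle Y,Z\rangle=\langle X,Y\circ Z\rangle+\langle X,Z\circ Y\rangle$. A $(1,1)$-tensor $N$ on $E$ is a smooth bundle endomorphism; $N^*$ is its transpose with respect to $\langle\cdot,\cdot\rangle$. Put $X\circ^NY=NX\circ Y+X\circ NY-N(X\circ Y)$; the Nijenhuis torsion is $T_\circ N(X,Y)=NX\circ NY-N(X\circ^NY)$. A Casimir function is $f\in\mathcal C^\infty(M)$ with $\rho(X)f=0$ for all $X$. The operator $\mathcal D:\mathcal C^\infty(M)\to\Gamma(E)$ is defined by $\langle\mathcal Df,X\rangle=\rho(X)f$. Grading on $V$: $\mathcal C^\infty(M)$ in degree $-2$, $\Gamma(E)$ in degree $-1$. The associated symmetric Lie $2$-algebra structure is (by definition) the vector valued form $\mu=l_1+l_2+l_3$ of degree $1$ with $l_1f=\mathcal Df$, $l_2(X,Y)=\frac12(X\circ Y-Y\circ X)$, $l_2(X,f)=l_2(f,X)=\frac12\langle X,\mathcal Df\rangle$, $l_3(X,Y,Z)=\frac1{12}\langle X\circ Y-Y\circ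 X,Z\rangle+$ cyclic permutations, for $X,Y,Z\in\Gamma(E)$, $f\in\mathcal C^\infty(M)$, and zero in all other cases. A symmetric vector valued $k$-form on a graded vector space $V$ is a graded symmetric $k$-linear map $K:V^k\to V$ ($k=0$: an element of $V$), of degree $\bar K$ if $|K(X_1,\dots,X_k)|=\sum|X_i|+\bar K$; vector valued forms are formal sums of these. For a $k$-form $K$ and an $l$-form $L$ ($l\ge1$), $\iota_KL(X_1,\dots,X_{k+l-1})=\sum_{\sigma\in Sh(k,l-1)}\epsilon(\sigma)L(K(X_{\sigma(1)},\dots,X_{\sigma(k)}),\dots,X_{\sigma(k+l-1)})$ (unshuffles, Koszul sign); $\iota_KL=0$ for $L\in V$; $\iota_XK=K(X,\cdot,\dots)$ for $X\in V$. $[K,L]_{_{RN}}=\iota_KL-(-1)^{\bar K\bar L}\iota_LK$, extended to formal sums. For $\mu$ of degree $1$, $\mathcal N$ of degree zero is Nijenhuis with respect to $\mu$ with square $\mathcal K$ (of degree zero) if $[\mathcal N,[\mathcal N,\mu]_{_{RN}}]_{_{RN}}=[\mathcal K,\mu]_{_{RN}}$ and $[\mathcal N,\mathcal K]_{_{RN}}=0$. *)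

(* Defs.v *)
From HB Require Import structures.
From mathcomp Require Import all_boot all_order all_algebra all_fingroup.
From mathcomp Require Import all_classical all_reals all_analysis.
Set Implicit Arguments.
Unset Strict Implicit.
Unset Printing Implicit Defensive.
Import Order.TTheory GRing.Theory Num.Theory.
Import numFieldNormedType.Exports.
Local Open Scope classical_set_scope.
Local Open Scope ring_scope.

(* Functions of class C^k on an open set [O] of R^n: [f] is continuous on [O]  *)
(* and its partial derivatives exist on [O] and are of class C^(k-1). Values   *)
(* outside [O] are irrelevant.                                                 *)
Section Smooth.
Variables (R : realType) (n : nat).

Fixpoint Ck (k : nat) (O : set 'rV[R]_n) (f : 'rV[R]_n -> R) : Prop :=
  (forall x, O x -> {for x, continuous f}) /\
  (if k is k'.+1 then
     forall i : 'I_n, (forall x, O x -> derivable f x (delta_mx 0 i)) /\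
                      Ck k' O ('D_(delta_mx 0 i) f)
   else True).

Definition Cinfty (O : set 'rV[R]_n) (f : 'rV[R]_n -> R) : Prop :=
  forall k, Ck k O f.

Lemma Ck_continuous k O f x : Ck k O f -> O x -> {for x, continuous f}.
Proof. by case: k => [|k] [] + _; exact. Qed.

Lemma Ck_ext k (O : set 'rV[R]_n) f g :
  open O -> {in O, f =1 g} -> Ck k O f -> Ck k O g.
Proof.
move=> oO fg.
have nfg (u v : 'rV[R]_n -> R) x : {in O, u =1 v} -> O x -> \near x, u x = v x.
  move=> uv Ox; apply: filterS (open_nbhs_nbhs (conj oO Ox)) => y Oy.
  by apply: uv; rewrite inE.
have cfg (u v : 'rV[R]_n -> R) x : {in O, u =1 v} -> O x ->
    {for x, continuous u} -> {for x, continuous v}.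
  move=> uv Ox cu; apply: cvg_trans (near_eq_cvg (nfg _ _ _ uv Ox)) _.
  by rewrite -(uv x) ?inE.
elim: k f g fg => [|k IH] f g fg [cf df].
  by split=> // x Ox; apply: cfg fg Ox (cf x Ox).
split=> [x Ox|i]; first exact: cfg fg Ox (cf x Ox).
have [d1 d2] := df i; split=> [x Ox|].
  exact: near_eq_derivable (nfg _ _ _ fg Ox) (d1 x Ox).
by apply: IH d2 => x; rewrite inE => Ox; apply: near_eq_derive; exact: nfg.
Qed.

Lemma Ck_sub k (O O' : set 'rV[R]_n) f : O' `<=` O -> Ck k O f -> Ck k O' f.
Proof.
move=> sO; elim: k f => [|k IH] f [cf df].
  by split=> // x Ox; apply: cf; exact: sO.
split=> [x Ox|i]; first by apply: cf; exact: sO.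
by have [d1 d2] := df i; split=> [x Ox|]; [apply: d1; exact: sO|exact: IH].
Qed.

Lemma Ck_local k (O : set 'rV[R]_n) f :
  (forall x, O x -> exists2 O', O' x & Ck k O' f) -> Ck k O f.
Proof.
elim: k f => [|k IH] f h.
  by split=> // x /h [U Ux [+ _]]; exact.
split=> [x /h [U Ux [+ _]]|i]; first exact.
split=> [x /h [U Ux [_ /(_ i) [+ _]]]|]; first exact.
by apply: IH => x /h [U Ux [_ /(_ i) [_ ?]]]; exists U.
Qed.

Lemma CkW k O f : Ck k.+1 O f -> Ck k O f.
Proof.
elim: k f => [|k IH] f [cf df]; split=> // i.
by have [d1 d2] := df i; split=> //; exact: IH.
Qed.

Lemma CkD k (O : set 'rV[R]_n) f g : open O -> Ck k O f -> Ck k O g ->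
  Ck k O (f + g).
Proof.
move=> oO; elim: k f g => [|k IH] f g [cf df] [cg dg].
  by split=> // x Ox; apply: continuousD; [exact: cf|exact: cg].
split=> [x Ox|i]; first by apply: continuousD; [exact: cf|exact: cg].
have [df1 df2] := df i; have [dg1 dg2] := dg i.
split=> [x Ox|]; first by apply: derivableD; [exact: df1|exact: dg1].
apply: Ck_ext oO _ (IH _ _ df2 dg2) => x; rewrite inE => Ox.
by rewrite deriveD//; [exact: df1|exact: dg1].
Qed.

Lemma CkM k (O : set 'rV[R]_n) f g : open O -> Ck k O f -> Ck k O g ->
  Ck k O (f * g).
Proof.
move=> oO; elim: k f g => [|k IH] f g Cf Cg.
  by split=> // x Ox; apply: continuousM; [exact: Cf.1|exact: Cg.1].
have [[cf df] [cg dg]] := (Cf, Cg).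
split=> [x Ox|i]; first by apply: continuousM; [exact: cf|exact: cg].
have [df1 df2] := df i; have [dg1 dg2] := dg i.
split=> [x Ox|]; first by apply: derivableM; [exact: df1|exact: dg1].
apply: Ck_ext oO _ (CkD oO (IH _ _ (CkW Cf) dg2) (IH _ _ (CkW Cg) df2)) => x.
rewrite inE => Ox.
by rewrite deriveM//; [exact: df1|exact: dg1].
Qed.

Lemma Ck_cst k (O : set 'rV[R]_n) (a : R) : Ck k O (cst a).
Proof.
elim: k a => [|k IH] a; first by split=> // x _; exact: cst_continuous.
split=> [x _|i]; first exact: cst_continuous.
split=> [x _|]; first exact: derivable_cst.
suff -> : 'D_(delta_mx 0 i) (cst a) = cst (0 : R) :> ('rV[R]_n -> R) by exact: IH.
by apply/funext => x; rewrite derive_cst.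
Qed.

End Smooth.

Section Manifold.
Variables (R : realType) (n : nat).

(* [cmap] and [cinv] only matter on [cdom] and [ccod]. *)
Record chart (M : topologicalType) := Chart {
  cdom : set M;
  ccod : set 'rV[R]_n;
  cmap : M -> 'rV[R]_n;
  cinv : 'rV[R]_n -> M;
  cdom_open : open cdom;
  ccod_open : open ccod;
  cmap_ccod : forall x, cdom x -> ccod (cmap x);
  cinv_cdom : forall y, ccod y -> cdom (cinv y);
  cmapK : forall x, cdom x -> cinv (cmap x) = x;
  cinvK : forall y, ccod y -> cmap (cinv y) = y;
  cmap_continuous : forall x, cdom x -> {for x, continuous cmap};
  cinv_continuous : forall y, ccod y -> {for y, continuous cinv} }.

Definition chart_image (M : topologicalType) (c : chart M) (W : set M)
  : set 'rV[R]_n := ccod c `&` cinv c @^-1` W.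

Record manifold := Manifold {
  mspace :> topologicalType;
  atlas : set (chart mspace);
  manifold_hausdorff : hausdorff_space mspace;
  manifold_second_countable : @second_countable mspace;
  atlas_cover : forall x, exists2 c, atlas c & cdom c x;
  atlas_compatible : forall c c', atlas c -> atlas c' -> forall j : 'I_n,
    Cinfty (chart_image c (cdom c')) (fun y => cmap c' (cinv c y) 0 j) }.

Variable M : manifold.

Definition smooth_on (W : set M) (f : M -> R) : Prop :=
  forall c, atlas c -> Cinfty (chart_image c W) (f \o cinv c).

Definition smooth (f : M -> R) : Prop := smooth_on setT f.

Lemma chart_image_open (c : chart M) (W : set M) :
  open W -> open (chart_image c W).
Proof.
move=> oW; rewrite openE => y [yc yW]; rewrite /interior.
apply: filterI; first by apply: open_nbhs_nbhs; split=> //; exact: ccod_open.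
by apply: (cinv_continuous yc); exact: open_nbhs_nbhs.
Qed.

Lemma smooth_on_cst W (a : R) : smooth_on W (cst a).
Proof. by move=> c _ k; exact: Ck_cst. Qed.

Lemma smooth_onD W f g : open W ->
  smooth_on W f -> smooth_on W g -> smooth_on W (f + g).
Proof.
by move=> oW sf sg c ac k; apply: CkD; [exact: chart_image_open|exact: sf|exact: sg].
Qed.

Lemma smooth_onM W f g : open W ->
  smooth_on W f -> smooth_on W g -> smooth_on W (f * g).
Proof.
by move=> oW sf sg c ac k; apply: CkM; [exact: chart_image_open|exact: sf|exact: sg].
Qed.

Lemma smooth_on_sum W (I : finType) (f : I -> M -> R) : open W ->
  (forall i, smooth_on W (f i)) -> smooth_on W (fun x => \sum_i f i x).
Proof.
move=> oW sf.
have -> : (fun x => \sum_i f i x) = \sum_i f i by apply/funext => x; rewrite fct_sumE.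
by elim/big_ind: _ => // [|g h]; [exact: (smooth_on_cst W 0)|exact: smooth_onD].
Qed.

Lemma smooth_on_ext W f g : open W -> {in W, f =1 g} ->
  smooth_on W f -> smooth_on W g.
Proof.
move=> oW fg sf c ac k; apply: (@Ck_ext _ _ _ _ (f \o cinv c)).
- exact: chart_image_open.
- by move=> y; rewrite inE => -[_ Wy] /=; apply: fg; rewrite inE.
- exact: sf.
Qed.

Lemma smooth_on_sub W W' f : W' `<=` W -> smooth_on W f -> smooth_on W' f.
Proof.
by move=> WW' sf c ac k; apply: Ck_sub (sf c ac k) => y [? /WW' ?].
Qed.

Lemma smooth_local f :
  (forall x, exists W, W x /\ smooth_on W f) -> smooth f.
Proof.
move=> h c ac k; apply: Ck_local => y [yc _].
by have [W [Wy sf]] := h (cinv c y); exists (chart_image c W); [|exact: sf].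
Qed.

Definition smooth_pred : {pred (M -> R)} := [pred f | `[< smooth f >]].

Lemma smooth_predP f : reflect (smooth f) (f \in smooth_pred).
Proof. exact: asboolP. Qed.

Lemma smooth_subring : subring_closed smooth_pred.
Proof.
have N f : smooth f -> smooth (- f).
  move=> sf; have -> : - f = cst (- 1) * f.
    by apply/funext => x; rewrite !fctE mulN1r.
  by apply: smooth_onM => //; [exact: openT|exact: smooth_on_cst].
split=> [|f g|f g].
- by apply/smooth_predP; exact: (smooth_on_cst _ 1).
- move=> /smooth_predP sf /smooth_predP sg; apply/smooth_predP.
  by apply: smooth_onD; [exact: openT|exact: sf|exact: N].
- move=> /smooth_predP sf /smooth_predP sg; apply/smooth_predP.
  by apply: smooth_onM => //; exact: openT.
Qed.

HB.instance Definition _ :=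
  GRing.isSubringClosed.Build (M -> R) smooth_pred smooth_subring.

Lemma smooth_scaler : GRing.scaler_closed smooth_pred.
Proof.
move=> a f /smooth_predP sf; apply/smooth_predP.
have -> : a *: f = cst a * f by apply/funext => x; rewrite !fctE.
by apply: smooth_onM => //; [exact: openT|exact: smooth_on_cst].
Qed.

HB.instance Definition _ :=
  GRing.isScaleClosed.Build R (M -> R) smooth_pred smooth_scaler.

(* C^oo(M), with its structures of commutative ring and of real vector space *)
Record smoothFun := SmoothFun {
  smooth_fun :> M -> R;
  smooth_funP : smooth_fun \in smooth_pred }.

HB.instance Definition _ := [isSub for smooth_fun].
HB.instance Definition _ := [Choice of smoothFun by <:].
HB.instance Definition _ := 
  GRing.SubChoice_isSubComPzRing.Build (M -> R) smooth_pred smoothFun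
    smooth_subring.
HB.instance Definition _ := [SubZmodule_isSubLmodule of smoothFun by <:].

Lemma smooth_funE (f : smoothFun) : smooth f.
Proof. exact/smooth_predP/smooth_funP. Qed.

Definition mkSmooth f (sf : smooth f) : smoothFun :=
  SmoothFun (introT (smooth_predP f) sf).

(* tangent vectors at [x], as derivations at [x] of the algebra C^oo(M) *)
Record tangent (x : M) := Tangent {
  tangent_fun :> smoothFun -> R;
  tangent_linear : forall (a : R) f g,
    tangent_fun (a *: f + g) = a * tangent_fun f + tangent_fun g;
  tangent_leibniz : forall f g,
    tangent_fun (f * g) = f x * tangent_fun g + g x * tangent_fun f }.

End Manifold.

Section VectorBundle.
Variables (R : realType) (n : nat) (M : manifold R n).

(* [tmap] restricts to linear isomorphisms E_x -> R^trank over [tdom]. *)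
Record trivialization (E : M -> lmodType R) := Trivialization {
  tdom : set M;
  trank : nat;
  tmap : forall x, E x -> 'rV[R]_trank;
  tinv : forall x, 'rV[R]_trank -> E x;
  tdom_open : open tdom;
  tmap_linear : forall x, tdom x -> linear (@tmap x);
  tmapK : forall x, tdom x -> cancel (@tmap x) (@tinv x);
  tinvK : forall x, tdom x -> cancel (@tinv x) (@tmap x) }.

Arguments tdom {E} t.
Arguments tmap {E} t {x}.
Arguments tinv {E} t x.
Arguments tdom_open {E} t.

Definition frame (E : M -> lmodType R) (t : trivialization E)
  (i : 'I_(trank t)) (x : M) : E x := tinv t x (delta_mx 0 i).

Arguments frame {E} t i x.

(* A smooth real vector bundle, given by its fibres and an atlas of local     *)
(* trivializations with smooth transition matrices; these determine the       *)
(* topology and the smooth structure of the total space. The rank is only     *)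
(* required to be locally constant.                                           *)
Record vectorBundle := VectorBundle {
  fibre :> M -> lmodType R;
  trivs : set (trivialization fibre);
  trivs_cover : forall x, exists2 t, trivs t & tdom t x;
  trivs_compatible : forall t t', trivs t -> trivs t' -> forall i j,
    smooth_on (tdom t `&` tdom t') (fun x => tmap t' (frame t i x) 0 j) }.

Variable E : vectorBundle.

Definition smooth_section (s : forall x, E x) : Prop :=
  forall t, trivs t -> forall j, smooth_on (tdom t) (fun x => tmap t (s x) 0 j).

(* Gamma(E) *)
Record section := Section_ {
  section_fun :> forall x, E x;
  section_smooth : smooth_section section_fun }.

Lemma section_ext (X Y : section) : (forall x, X x = Y x) -> X = Y.
Proof.
case: X Y => [f sf] [g sg] /= fg.
have {fg}fg : f = g by exact: functional_extensionality_dep.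
by subst g; congr Section_; exact: Prop_irrelevance.
Qed.

Lemma tmapD (t : trivialization E) x : tdom t x -> {morph tmap t (x := x) : u v / u + v}.
Proof.
by move=> tx u v; have := tmap_linear tx 1 u v; rewrite !scale1r.
Qed.

Lemma tmap0 (t : trivialization E) x : tdom t x -> tmap t (0 : E x) = 0.
Proof. by move=> tx; apply: (addrI (tmap t (0 : E x))); rewrite -tmapD// !addr0. Qed.

Lemma tmapZ (t : trivialization E) x a (u : E x) : tdom t x -> tmap t (a *: u) = a *: tmap t u.
Proof. by move=> tx; have := tmap_linear tx a u 0; rewrite tmap0 // !addr0. Qed.

Lemma tmap_sum (t : trivialization E) x (I : finType) (u : I -> E x) : tdom t x ->
  tmap t (\sum_i u i) = \sum_i tmap t (u i).
Proof. by move=> tx; apply: (big_morph _ (tmapD tx) (tmap0 tx)). Qed.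

Lemma frame_expand (t : trivialization E) x (e : E x) : tdom t x ->
  e = \sum_i tmap t e 0 i *: frame t i x.
Proof.
move=> tx; apply: (can_inj (tmapK tx)).
rewrite tmap_sum// {1}[tmap t e]row_sum_delta; apply: eq_bigr => i _.
by rewrite tmapZ// /frame tinvK.
Qed.

Lemma smooth_section0 : smooth_section (fun=> 0).
Proof.
move=> t tt j; apply: (smooth_on_ext (tdom_open t) _ (smooth_on_cst _ 0)) => x.
by rewrite inE => tx; rewrite tmap0// mxE.
Qed.

Lemma smooth_sectionD (X Y : section) : smooth_section (fun x => X x + Y x).
Proof.
move=> t tt j; apply: (smooth_on_ext (tdom_open t) _
  (smooth_onD (tdom_open t) (section_smooth X tt j) (section_smooth Y tt j))) => x.
by rewrite inE => tx; rewrite tmapD// mxE.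
Qed.

Lemma smooth_section_act (f : smoothFun M) (X : section) :
  smooth_section (fun x => f x *: X x).
Proof.
move=> t tt j; have sf : smooth_on (tdom t) f.
  by apply: smooth_on_sub (smooth_funE f).
apply: (smooth_on_ext (tdom_open t) _
  (smooth_onM (tdom_open t) sf (section_smooth X tt j))) => x.
by rewrite inE => tx; rewrite tmapZ// mxE.
Qed.

Lemma smooth_sectionZ (a : R) (X : section) :
  smooth_section (fun x => a *: X x).
Proof. exact: (smooth_section_act (mkSmooth (smooth_on_cst setT a))). Qed.

Lemma smooth_sectionN (X : section) : smooth_section (fun x => - X x).
Proof.
have -> : (fun x => - X x) = (fun x => -1 *: X x).
  by apply: functional_extensionality_dep => x; rewrite scaleN1r.
exact: smooth_sectionZ.
Qed.

HB.instance Definition _ := gen_eqMixin section.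
HB.instance Definition _ := gen_choiceMixin section.

Definition section_zero := Section_ smooth_section0.
Definition section_add X Y := Section_ (smooth_sectionD X Y).
Definition section_opp X := Section_ (smooth_sectionN X).
Definition section_scale a X := Section_ (smooth_sectionZ a X).

Fact section_addA : associative section_add.
Proof. by move=> X Y Z; apply: section_ext => x /=; rewrite addrA. Qed.
Fact section_addC : commutative section_add.
Proof. by move=> X Y; apply: section_ext => x /=; rewrite addrC. Qed.
Fact section_add0 : left_id section_zero section_add.
Proof. by move=> X; apply: section_ext => x /=; rewrite add0r. Qed.
Fact section_addN : left_inverse section_zero section_opp section_add.
Proof. by move=> X; apply: section_ext => x /=; rewrite addNr. Qed.

HB.instance Definition _ := GRing.isZmodule.Build section
  section_addA section_addC section_add0 section_addN.

Fact section_scaleA a b X :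
  section_scale a (section_scale b X) = section_scale (a * b) X.
Proof. by apply: section_ext => x /=; rewrite scalerA. Qed.
Fact section_scale1 : left_id 1 section_scale.
Proof. by move=> X; apply: section_ext => x /=; rewrite scale1r. Qed.
Fact section_scaleDr : right_distributive section_scale +%R.
Proof. by move=> a X Y; apply: section_ext => x /=; rewrite scalerDr. Qed.
Fact section_scaleDl X : {morph section_scale^~ X : a b / a + b}.
Proof. by move=> a b; apply: section_ext => x /=; rewrite scalerDl. Qed.

HB.instance Definition _ := GRing.Zmodule_isLmodule.Build R section
  section_scaleA section_scale1 section_scaleDr section_scaleDl.

(* multiplication of a section by a function *)
Definition fscale (f : smoothFun M) (X : section) : section :=
  Section_ (smooth_section_act f X).

(* (1,1)-tensors on E *)
Record bundleEndo := BundleEndo {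
  endo :> forall x, E x -> E x;
  endo_linear : forall x, linear (@endo x);
  endo_smooth : forall t, trivs t -> forall i j,
    smooth_on (tdom t) (fun x => tmap t (@endo x (frame t i x)) 0 j) }.

Arguments endo b x _ : clear implicits.

Lemma endo_expand (N : bundleEndo) (t : trivialization E) x (e : E x) : tdom t x ->
  tmap t (N x e) = \sum_i tmap t e 0 i *: tmap t (N x (frame t i x)).
Proof.
move=> tx; have ND : {morph N x : u v / u + v}.
  by move=> u v; have := endo_linear N 1 u v; rewrite !scale1r.
have N0 : N x 0 = 0 by apply: (addrI (N x 0)); rewrite -ND !addr0.
rewrite {1}(frame_expand e tx) (big_morph _ ND N0) tmap_sum//.
apply: eq_bigr => i _; rewrite -tmapZ//; congr tmap.
by have := endo_linear N (tmap t e 0 i) (frame t i x) 0; rewrite N0 !addr0.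
Qed.

Lemma smooth_section_endo (N : bundleEndo) (X : section) :
  smooth_section (fun x => N x (X x)).
Proof.
move=> t tt j; apply: (smooth_on_ext (tdom_open t) _ (smooth_on_sum
  (tdom_open t) (fun i => smooth_onM (tdom_open t) (section_smooth X tt i)
  (endo_smooth N tt i j)))) => x.
rewrite inE => tx; rewrite endo_expand// summxE.
by apply: eq_bigr => i _; rewrite mxE.
Qed.

Definition endo_section (N : bundleEndo) (X : section) : section :=
  Section_ (smooth_section_endo N X).

End VectorBundle.

Arguments tdom {R n M E} t.
Arguments tmap {R n M E} t {x}.
Arguments tinv {R n M E} t x.
Arguments tdom_open {R n M E} t.
Arguments frame {R n M E} t i x.
Arguments endo {R n M E} b x _.

Section Courant.
Variables (R : realType) (n : nat) (M : manifold R n) (E : vectorBundle M).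

Record metric := Metric {
  inner :> forall x, E x -> E x -> R;
  inner_sym : forall x (u v : E x), inner u v = inner v u;
  inner_linear : forall x (a : R) (u v w : E x),
    inner (a *: u + v) w = a * inner u w + inner v w;
  inner_nondegenerate : forall x (u : E x), (forall v, inner u v = 0) -> u = 0;
  inner_smooth : forall t, trivs t -> forall i j,
    smooth_on (tdom t) (fun x => inner (frame t i x) (frame t j x)) }.

Arguments inner m x _ _ : clear implicits.

Lemma inner_expand (g : metric) (t : trivialization E) x (u v : E x) :
  tdom t x ->
  g x u v = \sum_i \sum_j
    tmap t u 0 i * (tmap t v 0 j * g x (frame t i x) (frame t j x)).
Proof.
move=> tx.
have l0 w : g x 0 w = 0.
  apply: (addrI (g x 0 w)).
  by have := inner_linear g 1 0 0 w; rewrite scale1r mul1r !addr0 => <-.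
have sumE (I : finType) (c : I -> R) (e : I -> E x) w :
    g x (\sum_i c i *: e i) w = \sum_i c i * g x (e i) w.
  apply: (big_rec2 (fun a b => g x a w = b)) => [|i a b _ <-]; first exact: l0.
  exact: inner_linear.
rewrite {1}(frame_expand u tx) sumE; apply: eq_bigr => i _.
rewrite {1}(frame_expand v tx) inner_sym sumE mulr_sumr.
by apply: eq_bigr => j _; rewrite inner_sym.
Qed.

Lemma smooth_inner (g : metric) (X Y : section E) :
  smooth (fun x => g x (X x) (Y x)).
Proof.
apply: smooth_local => x; have [t tt tx] := trivs_cover E x.
exists (tdom t); split=> //; have oW := tdom_open t.
apply: (smooth_on_ext oW _ (smooth_on_sum oW (fun i => smooth_on_sum oW (fun j =>
  smooth_onM oW (section_smooth X tt i) (smooth_onM oW (section_smooth Y tt j)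
  (inner_smooth g tt i j)))))) => y.
by rewrite inE => ty; rewrite (inner_expand g _ _ ty).
Qed.

Definition pairing (g : metric) (X Y : section E) : smoothFun M :=
  mkSmooth (smooth_inner g X Y).

(* [anchor] is a bundle morphism E -> TM; it is smooth when it maps the local *)
(* frames of E to smooth vector fields, i.e. to vector fields along which     *)
(* every smooth function has a smooth derivative.                             *)
Record courantAlgebroid := CourantAlgebroid {
  cmetric : metric;
  anchor : forall x, E x -> tangent x;
  anchor_linear : forall x (a : R) (u v : E x) f,
    anchor (a *: u + v) f = a * anchor u f + anchor v f;
  anchor_smooth : forall t, trivs t -> forall i f,
    smooth_on (tdom t) (fun x => anchor (frame t i x) f);
  dorfman : section E -> section E -> section E;
  dorfman_linearl : forall (a : R) X Y Z,
    dorfman (a *: X + Y) Z = a *: dorfman X Z + dorfman Y Z;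
  dorfman_linearr : forall (a : R) X Y Z,
    dorfman X (a *: Y + Z) = a *: dorfman X Y + dorfman X Z;
  dorfman_jacobi : forall X Y Z,
    dorfman X (dorfman Y Z) = dorfman (dorfman X Y) Z + dorfman Y (dorfman X Z);
  dorfman_metric : forall (X Y Z : section E) x,
    anchor (X x) (pairing cmetric Y Z) =
    pairing cmetric (dorfman X Y) Z x + pairing cmetric Y (dorfman X Z) x;
  dorfman_sym : forall (X Y Z : section E) x,
    anchor (X x) (pairing cmetric Y Z) =
    pairing cmetric X (dorfman Y Z) x + pairing cmetric X (dorfman Z Y) x }.

Variable C : courantAlgebroid.

Local Notation "X ** Y" := (dorfman C X Y) (at level 40).
Local Notation ip := (pairing (cmetric C)).

Definition casimir (f : smoothFun M) : Prop :=
  forall (X : section E) x, anchor C (X x) f = 0.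

(* The section and the vector picked below exist and are unique, since the    *)
(* metric is smooth and nondegenerate and the fibres are finite-dimensional.  *)
Definition calD (f : smoothFun M) : section E :=
  xget 0 [set s : section E | forall (X : section E) x, ip s X x = anchor C (X x) f].

Definition transpose (A : forall x, E x -> E x) (x : M) (e : E x) : E x :=
  xget 0 [set e' | forall v, inner (cmetric C) x (A x v) e =
                             inner (cmetric C) x v e'].

Definition deformed (N : bundleEndo E) (X Y : section E) : section E :=
  endo_section N X ** Y + X ** endo_section N Y - endo_section N (X ** Y).

Definition torsion (N : bundleEndo E) (X Y : section E) : section E :=
  endo_section N X ** endo_section N Y - endo_section N (deformed N X Y).

End Courant.

(* Vector valued forms on a vector space [V] graded by the subspaces [G i].   *)
(* A formal sum of k-forms (k >= 0) is a function on sequences, whose k-form  *)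
(* component is its restriction to the sequences of length k.                 *)
Section Forms.
Variables (R : fieldType) (V : lmodType R) (G : int -> set V).

Definition vvform := seq V -> V.

Definition homogeneous (x : V) : Prop := exists i, G i x.

(* unspecified for 0, whose degree never matters by multilinearity *)
Definition hdegree (x : V) : int := xget 0 [set i | G i x].

Definition form_of_degree (d : int) (K : vvform) : Prop :=
  [/\ forall s1 s2 (a : R) x y,
        K (s1 ++ (a *: x + y) :: s2) = a *: K (s1 ++ x :: s2) + K (s1 ++ y :: s2),
      forall s1 s2 i j x y, G i x -> G j y ->
        K (s1 ++ x :: y :: s2) = (-1) ^ (i * j) *: K (s1 ++ y :: x :: s2) &
      forall (s : seq V) (ds : seq int), size ds = size s ->
        (forall k, (k < size s)%N -> G (nth 0 ds k) (nth 0 s k)) ->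
        G (\sum_(i <- ds) i + d) (K s)].

(* forms are multilinear, hence determined by their values on homogeneous     *)
(* elements, on which alone Koszul signs make sense                           *)
Definition form_eq (K L : vvform) : Prop :=
  forall s : seq V, (forall x, x \in s -> homogeneous x) -> K s = L s.

Definition one_form (phi : V -> V) : vvform :=
  fun s => if s is [:: x] then phi x else 0.

(* p is in Sh(k, m - k) *)
Definition unshuffle (m k : nat) (p : 'S_m) : bool :=
  [forall i : 'I_m, forall j : 'I_m,
    ((i < j)%N && ((j < k)%N || (k <= i)%N)) ==> (p i < p j)%N].

Definition reorder (s : seq V) (p : 'S_(size s)) : seq V :=
  [seq nth 0 s (p i) | i <- enum 'I_(size s)].

Definition koszul (s : seq V) (p : 'S_(size s)) : R :=
  \prod_(i < size s) \prod_(j < size s | (i < j)%N && (p j < p i)%N)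
    (-1) ^ (hdegree (nth 0 s (p i)) * hdegree (nth 0 s (p j))).

(* iota_K L *)
Definition insertion (K L : vvform) : vvform := fun s =>
  \sum_(k < (size s).+1) \sum_(p : 'S_(size s) | unshuffle k p)
    koszul p *: L (K (take k (reorder p)) :: drop k (reorder p)).

(* the Richardson-Nijenhuis bracket of forms of degrees [dK] and [dL] *)
Definition bracketRN (dK dL : int) (K L : vvform) : vvform := fun s =>
  insertion K L s - (-1) ^ (dK * dL) *: insertion L K s.

Definition nijenhuis_with_square (mu N K : vvform) : Prop :=
  [/\ form_of_degree 1 mu, form_of_degree 0 N, form_of_degree 0 K,
      form_eq (bracketRN 0 1 N (bracketRN 0 1 N mu)) (bracketRN 0 1 K mu) &
      form_eq (bracketRN 0 0 N K) (fun=> 0)].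

End Forms.

Section Lie2.
Variables (R : realType) (n : nat) (M : manifold R n) (E : vectorBundle M).
Variable C : courantAlgebroid E.

Local Notation "X ** Y" := (dorfman C X Y) (at level 40).
Local Notation ip := (pairing (cmetric C)).

Definition lie2_space : lmodType R := (smoothFun M * section E)%type.

Definition lie2_grading (i : int) : set lie2_space :=
  [set v | if i == - 2 then v.2 = 0 else if i == - 1 then v.1 = 0 else v = 0].

(* [l1], [l2], [l3] are given on arbitrary, not necessarily homogeneous,       *)
(* elements (f, X), by multilinear extension.                                 *)
Definition l1 (u : lie2_space) : lie2_space := (0, calD C u.1).

Definition l2 (u v : lie2_space) : lie2_space :=
  (2^-1 *: ip u.2 (calD C v.1) + 2^-1 *: ip v.2 (calD C u.1),
   2^-1 *: (u.2 ** v.2 - v.2 ** u.2)).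

Definition l3 (u v w : lie2_space) : lie2_space :=
  (12^-1 *: ip (u.2 ** v.2 - v.2 ** u.2) w.2 +
   12^-1 *: ip (v.2 ** w.2 - w.2 ** v.2) u.2 +
   12^-1 *: ip (w.2 ** u.2 - u.2 ** w.2) v.2, 0).

Definition lie2_structure : vvform lie2_space := fun s =>
  match s with
  | [:: u] => l1 u
  | [:: u; v] => l2 u v
  | [:: u; v; w] => l3 u v w
  | _ => 0
  end.

End Lie2.

(* Main.v *)
Require Import Defs.
From HB Require Import structures.
From mathcomp Require Import all_boot all_order all_algebra all_fingroup.
From mathcomp Require Import all_classical all_reals all_analysis.
From mathcomp Require Import zify ring lra.
Set Implicit Arguments.
Unset Strict Implicit.
Unset Printing Implicit Defensive.
Import Order.TTheory GRing.Theory Num.Theory.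
Import numFieldNormedType.Exports.
Local Open Scope classical_set_scope.
Local Open Scope ring_scope.

(** For a grade-preserving linear map phi, bracketing with the associated 1-form
    is the derivation [L |-> sum_i L(.., phi x_i, ..) - phi (L ..)], so the claim
    reads [D_N (D_N mu) = D_K mu] and splits along l1, l2, l3.  Vanishing torsion
    makes the second derivation of the Dorfman product by N the derivation by N^2,
    and N + N^* = lam, N^2 + (N^2)^* = gam give
    2 N^2 = 2 lam N + gam - lam^2 and <W, NZ> = lam <W, Z> - <NW, Z>; with
    D (lam f) = lam D f for Casimirs these settle every component.

    That D is well defined and linear rests on two facts: the Gram matrix of the
    metric in a local frame has a smooth inverse, which gives existence, and every
    vector of a fibre is the value of a global section, by a bump function built
    from exp(-1/t), which gives uniqueness. *)

(** * Flat functions built from exp(-1/t), and [Ck] stability under composition and inversion *)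

Section FlatFunction.
Variable R : realType.

(** The factors [t ^- k] make the family stable under differentiation: the derivative of [flat k] is
    a combination of [flat k.+1] and [flat k.+2]. *)
Definition flat (k : nat) (t : R) : R :=
  if 0 < t then t ^- k * expR (- t^-1) else 0.

Lemma flat_gt0 k t : 0 < t -> 0 < flat k t.
Proof. by move=> t0; rewrite /flat t0 mulr_gt0 ?expR_gt0// invr_gt0 exprn_gt0. Qed.

Lemma flat_le0 k t : t <= 0 -> flat k t = 0.
Proof. by rewrite /flat ltNge => ->. Qed.

Lemma flatS k t : flat k t = t * flat k.+1 t.
Proof.
rewrite /flat; case: ifPn => [t0|_]; last by rewrite mulr0.
by rewrite exprS invfM !mulrA divff ?gt_eqF// mul1r.
Qed.

(* [exp u >= u^(k+1) / (k+1)!] at [u = 1/t]. *)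
Lemma flat_bound k t : `|flat k t| <= (k.+1`!)%:R * `|t|.
Proof.
rewrite /flat; case: ifPn => [t0|_]; last by rewrite normr0 mulr_ge0.
have u0 : 0 < t^-1 by rewrite invr_gt0.
rewrite !gtr0_norm//; last by rewrite mulr_gt0 ?expR_gt0// invr_gt0 exprn_gt0.
rewrite expRN ler_pdivrMr ?expR_gt0//.
have := expR_ge1Dxn k (ltW u0) => h.
have {h} h : t^-1 ^+ k.+1 / k.+1`!%:R <= expR t^-1 by apply: le_trans h; rewrite lerDr.
rewrite -exprVn; apply: (@le_trans _ _ (k.+1`!%:R * t * (t^-1 ^+ k.+1 / k.+1`!%:R))).
  rewrite exprS; suff -> : k.+1`!%:R * t * (t^-1 * t^-1 ^+ k / k.+1`!%:R) = t^-1 ^+ k by [].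
  by field; rewrite pnatr_eq0 -lt0n fact_gt0 gt_eqF.
by rewrite ler_pM2l// mulr_gt0// ltr0n fact_gt0.
Qed.

Lemma flat_cvg0 k : flat k @ (0 : R) --> (0 : R).
Proof.
apply: norm_cvg0; apply: (@squeeze_cvgr _ _ _ _ (cst 0) (fun t => (k.+1`!)%:R * `|t|)).
- by near=> t; rewrite normr_ge0 flat_bound.
- exact: cvg_cst.
- rewrite -[X in _ --> X](mulr0 (k.+1`!)%:R); apply: cvgM; first exact: cvg_cst.
  by apply/norm_cvg0P; exact: cvg_id.
Unshelve. all: end_near. Qed.

Lemma is_derive_flat k (t : R) : is_derive t 1 (flat k) (flat k.+2 t - k%:R * flat k.+1 t).
Proof.
have [t0|t0|->] := ltgtP t 0.
- apply: (@near_eq_is_derive _ _ _ (cst 0)).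
    by apply: filterS (lt_nbhsl t0) => s /ltW s0; rewrite flat_le0.
  by rewrite !flat_le0 ?ltW// mulr0 subr0; exact: is_derive_cst.
- have tn0 : t != 0 by rewrite gt_eqF.
  have dV : is_derive t 1 (fun s : R => s^-1) (- t ^- 2).
    by rewrite -[- _]mulr1; apply: is_deriveV.
  have dE : is_derive t 1 (fun s : R => expR (- s^-1)) (expR (- t^-1) * t ^- 2).
    by rewrite -[t ^- 2]opprK; apply: is_derive1_comp.
  have dP : is_derive t 1 (fun s : R => s ^- k) (- (k%:R * t ^- k.+1)).
    rewrite (_ : (fun s : R => s ^- k) = (fun s : R => s^-1) ^+ k); last first.
      by apply/funext => s; rewrite -exprVn; elim: k => // k IH; rewrite !exprS IH.
    apply: is_derive_eq; rewrite -!exprVn.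
    transitivity (k%:R * t^-1 ^+ k.-1 * - t^-1 ^+ 2) => //.
    by case: k => [|k]; rewrite /= ?mul0r ?oppr0// !exprS; ring.
  have := is_deriveM dP dE.
  rewrite (_ : _ *: _ + _ = flat k.+2 t - k%:R * flat k.+1 t); last first.
    rewrite /flat t0 -!exprVn.
    transitivity (t^-1 ^+ k * (expR (- t^-1) * t^-1 ^+ 2) +
      expR (- t^-1) * - (k%:R * t^-1 ^+ k.+1)) => //.
    by rewrite !exprS; ring.
  apply: near_eq_is_derive.
  by apply: filterS (lt_nbhsr t0) => s s0; rewrite /flat s0.
- rewrite !flat_le0// mulr0 subr0.
  (* Since [flat k 0 = 0], the difference quotient at 0 is [flat k h / h], which is [flat k.+1 h]
     and tends to 0. *)
  have cv : (fun h : R => h^-1 *: ((flat k \o shift 0) (h *: 1) - flat k 0)) @ 0^' --> (0 : R).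
    have c : flat k.+1 @ (0 : R)^' --> (0 : R) by exact: cvg_within_filter (@flat_cvg0 k.+1).
    apply: cvg_trans c.
    apply: near_eq_cvg; near=> h.
    have hn0 : h != 0 by near: h; exact: nbhs_dnbhs_neq.
    rewrite /= addr0 [h *: 1]mulr1 (flat_le0 k (lexx 0)) subr0 (flatS k).
    by transitivity (h^-1 * (h * flat k.+1 h)) => //; rewrite mulrA mulVf ?mul1r.
  by apply: DeriveDef; [apply/cvg_ex; exists 0|exact: cvg_lim cv].
Unshelve. all: end_near. Qed.

Variables (n : nat) (O : set 'rV[R]_n).
Hypothesis oO : open O.

(** Restricting [g] to the line [h *: v + x] reduces this to the chain rule in one variable, so only
    a directional derivative of [g] is assumed. *)
Lemma is_derive_comp1 (f : R -> R) (g : 'rV[R]_n -> R) x v df dg :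
  is_derive (g x) 1 f df -> is_derive x v g dg -> is_derive x v (f \o g) (df * dg).
Proof.
move=> Df Dg.
have Dg0 : is_derive (0 : R) 1 (fun h => g (h *: v + x)) dg.
  case: Dg => dgx <-; apply: DeriveDef; first exact: (derivable1P g x v).1.
  rewrite /derive; apply: (congr1 (fun F : R -> R => lim (F @ 0^'))); apply/funext => h /=.
  by rewrite addr0 scale0r add0r [_ *: 1]mulr1.
have gx0 : g x = (fun h : R => g (h *: v + x)) 0 by rewrite /= scale0r add0r.
rewrite gx0 in Df.
have [d e] := is_derive1_comp Df Dg0.
apply: DeriveDef; first exact: (derivable1P (f \o g) x v).2.
rewrite -e /derive; apply: (congr1 (fun F : R -> R => lim (F @ 0^'))); apply/funext => h /=.
by rewrite addr0 scale0r add0r [_ *: 1]mulr1.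
Qed.

Lemma CkN k f : Ck k O f -> Ck k O (- f).
Proof.
by move=> Cf; rewrite -mulN1r; apply: CkM => //; exact: (Ck_cst k O (-1)).
Qed.

(** The induction on [k] runs over all [m] at once, because differentiating [flat m \o g] brings in
    [flat m.+1 \o g] and [flat m.+2 \o g]. *)
Lemma Ck_flat k m g : Ck k O g -> Ck k O (flat m \o g).
Proof.
elim: k m g => [|k IH] m g [cg dg].
  split=> // x Ox; apply: continuous_comp; first exact: cg.
  by have [d _] := is_derive_flat m (g x); exact/differentiable_continuous/derivable1_diffP.
split=> [x Ox|i].
  apply: continuous_comp; first exact: cg.
  by have [d _] := is_derive_flat m (g x); exact/differentiable_continuous/derivable1_diffP.
have Cg : Ck k O g by exact: CkW.
have [dg1 dg2] := dg i.
have D x : O x -> is_derive x (delta_mx 0 i) (flat m \o g)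
    ((flat m.+2 (g x) - m%:R * flat m.+1 (g x)) * 'D_(delta_mx 0 i) g x).
  by move=> Ox; apply: is_derive_comp1; [exact: is_derive_flat|exact/derivableP/dg1].
split=> [x /D[]//|].
apply: (@Ck_ext _ _ _ _ ((flat m.+2 \o g - cst m%:R * (flat m.+1 \o g)) *
  'D_(delta_mx 0 i) g)) => //.
  by move=> x; rewrite inE => /D[_ ->].
apply: CkM => //; apply: CkD => //; first exact: IH.
by apply: CkN; apply: CkM => //; [exact: Ck_cst|exact: IH].
Qed.

(** A partial derivative of 1/g is -(1/g)(1/g) times that of g, and the induction hypothesis already
    makes 1/g one class less regular. *)
Lemma Ck_inv k g : (forall x, O x -> g x != 0) -> Ck k O g ->
  Ck k O (fun x => (g x)^-1).
Proof.
move=> g0; elim: k => [|k IH] Cg.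
  by split=> // x Ox; apply: continuousV; [exact: g0|exact: Cg.1].
split=> [x Ox|i]; first by apply: continuousV; [exact: g0|exact: Cg.1].
have [dg1 dg2] := Cg.2 i; split=> [x Ox|].
  by apply: derivableV; [exact: g0|exact: dg1].
pose G x := (g x)^-1.
have CG : Ck k O G by apply/IH/CkW.
apply: (@Ck_ext _ _ _ _ (- (G * G) * 'D_(delta_mx 0 i) g)) => //.
  move=> x; rewrite inE => Ox; rewrite deriveV; [|exact: g0|exact: dg1].
  by rewrite expr2 invfM.
by apply: CkM => //; apply: CkN; exact: CkM.
Qed.


End FlatFunction.

(** * Smooth functions on the manifold: matrix inverses and bump functions *)

Section SmoothOn.
Variables (R : realType) (n : nat) (M : manifold R n).

Lemma smooth_on_local (W : set M) f :
  (forall x, W x -> exists2 W', W' x & smooth_on W' f) -> smooth_on W f.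
Proof.
move=> h c ac k; apply: Ck_local => y [yc /h[W' W'y sf]].
by exists (chart_image c W'); [|exact: sf].
Qed.

Lemma smooth_on_flat (W : set M) m f : open W -> smooth_on W f -> smooth_on W (flat m \o f).
Proof. by move=> oW sf c ac k; apply: Ck_flat; [exact: chart_image_open|exact: sf]. Qed.

Lemma smooth_on_inv (W : set M) f : open W -> (forall x, W x -> f x != 0) ->
  smooth_on W f -> smooth_on W (fun x => (f x)^-1).
Proof.
move=> oW f0 sf c ac k; apply: (@Ck_inv _ _ _ _ k (f \o cinv c)).
- exact: chart_image_open.
- by move=> y [_ Wy]; exact: f0.
- exact: sf.
Qed.

Lemma smooth_on_prod (W : set M) (I : finType) (f : I -> M -> R) : open W ->
  (forall i, smooth_on W (f i)) -> smooth_on W (fun x => \prod_i f i x).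
Proof.
move=> oW sf.
have -> : (fun x => \prod_i f i x) = \prod_i f i by apply/funext => x; rewrite fct_prodE.
by elim/big_ind: _ => // [|g h]; [exact: (smooth_on_cst W 1)|exact: smooth_onM].
Qed.

Lemma smooth_on_det (W : set M) m (A : M -> 'M[R]_m) : open W ->
  (forall i j, smooth_on W (fun x => A x i j)) -> smooth_on W (fun x => \det (A x)).
Proof.
move=> oW sA; apply: smooth_on_sum => // s.
apply: smooth_onM => //; first exact: smooth_on_cst.
exact: (smooth_on_prod (f := fun i x => A x i (s i))).
Qed.

(** Cramer's rule: each entry is a cofactor divided by the nonvanishing determinant, and both are
    polynomial in the entries of [A]. *)
Lemma smooth_on_invmx (W : set M) m (A : M -> 'M[R]_m) : open W ->
  (forall x, W x -> A x \in unitmx) ->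
  (forall i j, smooth_on W (fun x => A x i j)) ->
  forall i j, smooth_on W (fun x => invmx (A x) i j).
Proof.
move=> oW Au sA i j.
apply: (@smooth_on_ext _ _ _ _ ((fun x => (\det (A x))^-1) * (fun x => cofactor (A x) j i))) => //.
  by move=> x; rewrite inE => /Au xu; rewrite /invmx xu !mxE.
apply: smooth_onM => //.
  by apply: smooth_on_inv (smooth_on_det oW sA) => // x /Au; rewrite unitmxE unitfE.
apply: smooth_onM => //; first exact: smooth_on_cst.
apply: smooth_on_det => // k l.
by apply: smooth_on_ext (sA (lift j k) (lift i l)) => // x _; rewrite !mxE.
Qed.

(* [flat 0 (d^2 - |y - y0|^2)] in a chart, extended by 0: its support is the image
   of a compact box, hence closed in [M] because [M] is Hausdorff. *)
Lemma bump_function (W : set M) x0 : open W -> W x0 ->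
  exists K (b : M -> R), [/\ closed K, K `<=` W, smooth b, b x0 != 0 &
    forall x, ~ K x -> b x = 0].
Proof.
move=> oW Wx0; have [c ac cx0] := atlas_cover x0.
pose y0 := cmap c x0.
have Oy0 : chart_image c W y0 by split; [exact: cmap_ccod|rewrite /= cmapK].
have /nbhs_ballP[e /= e0 eO] : nbhs y0 (chart_image c W).
  by apply: open_nbhs_nbhs; split=> //; exact: chart_image_open.
(* Halving the radius puts the closed box [B] inside the open ball of radius [e]; balls of row
   vectors are cubes. *)
pose d := e / 2; have d0 : 0 < d by rewrite divr_gt0.
pose B := [set y : 'rV[R]_n | forall i, `[y0 0 i - d, y0 0 i + d]%classic (y ord0 i)].
have BO : B `<=` chart_image c W.
  move=> y By; apply: eO; split=> // i j; rewrite ord1.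
  have := By j; rewrite /= in_itv /= => /andP[h1 h2].
  rewrite /ball /= ltr_distlC; move: h1 h2; rewrite /d; lra.
have cB : compact B.
  apply: (@rV_compact R n (fun i => `[y0 0 i - d, y0 0 i + d]%classic)) => i.
  exact: segment_compact.
pose K := cinv c @` B.
have cK : compact K.
  apply: continuous_compact => //; apply: continuous_in_subspaceT => y.
  by rewrite inE => /BO[yc _]; exact: cinv_continuous.
have clK : closed K by apply: compact_closed => //; exact: manifold_hausdorff.
pose q (x : M) : R := d ^+ 2 + (-1) * \sum_i (cmap c x 0 i - y0 0 i) ^+ 2.
pose b (x : M) : R := if `[< cdom c x >] then flat 0 (q x) else 0.
have bK x : ~ K x -> b x = 0.
  move=> nKx; rewrite /b; case: asboolP => // cx; apply: flat_le0.
  (* Some coordinate lies farther than [d] from that of [y0], so its square alone makes [q x]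
     nonpositive. *)
  have /existsNP[i] : ~ B (cmap c x).
    by move=> Bx; apply: nKx; exists (cmap c x) => //; exact: cmapK.
  rewrite /= in_itv /= => /negP; rewrite -ler_distlC -ltNge => di.
  rewrite /q mulN1r subr_le0 (bigD1 i)//= -[leLHS]addr0 lerD//; last first.
    by apply: sumr_ge0 => j _; exact: sqr_ge0.
  rewrite -[leRHS]sqrrN opprB -[leRHS]real_normK ?num_real//.
  by rewrite ler_sqr ?nnegrE ?normr_ge0 ?(ltW d0) ?(ltW di).
have sq : smooth_on (cdom c) q.
  apply: (@smooth_onD _ _ _ _ (cst (d ^+ 2))
    (cst (-1) * fun x => \sum_i (cmap c x 0 i - y0 0 i) ^+ 2)).
  - exact: cdom_open.
  - exact: smooth_on_cst.
  apply: smooth_onM; [exact: cdom_open|exact: smooth_on_cst|].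
  apply: smooth_on_sum => [|i]; first exact: cdom_open.
  have si : smooth_on (cdom c) (fun x => cmap c x 0 i - y0 0 i).
    apply: (@smooth_onD _ _ _ _ (fun x => cmap c x 0 i) (cst (- y0 0 i))).
    - exact: cdom_open.
    - by move=> c' ac'; exact: (atlas_compatible ac' ac).
    - exact: smooth_on_cst.
  by apply: smooth_onM => //; exact: cdom_open.
exists K, b; split=> //.
- by move=> _ [y /BO[_ +] <-].
- apply: smooth_local => x; have [cx|ncx] := pselect (cdom c x).
    exists (cdom c); split=> //.
    apply: smooth_on_ext (smooth_on_flat 0 (cdom_open c) sq); first exact: cdom_open.
    by move=> z; rewrite inE => cz; rewrite /b asboolT.
  (* Off the chart domain, the complement of the closed set [K] is a neighbourhood on which [b] is
     identically 0. *)
  exists (~` K); split.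
    by move=> [y /BO[yc _] xy]; apply: ncx; rewrite -xy; exact: cinv_cdom.
  apply: (smooth_on_ext _ _ (smooth_on_cst _ 0)).
    exact: closed_openC.
  by move=> z; rewrite inE => /bK ->.
- rewrite /b asboolT// gt_eqF// flat_gt0// /q big1 ?mulr0 ?addr0 ?exprn_gt0// => i _.
  by rewrite subrr expr0n.
Qed.

End SmoothOn.

(** * Global sections, the Gram matrix, and existence of [calD] and of transposes *)

Section Sections.
Variables (R : realType) (n : nat) (M : manifold R n) (E : vectorBundle M).

(** Frame sections times a bump function extend by 0 to all of [M]; dividing the coordinates of [v]
    by [b x] undoes the bump factor at [x]. Conditions stated for sections can then be used at any
    single vector. *)
Lemma section_extension x (v : E x) : exists X : section E, X x = v.
Proof.
have [t tt tx] := trivs_cover E x.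
have [K [b [clK KW sb b0 bK]]] := bump_function (tdom_open t) tx.
pose s i y : E y := if `[< tdom t y >] then b y *: frame t i y else 0.
have ss i : smooth_section (s i).
  move=> t' tt' j; apply: smooth_on_local => y t'y.
  have [ty|nty] := pselect (tdom t y).
    exists (tdom t `&` tdom t') => //.
    have oI : open (tdom t `&` tdom t') by apply: openI; exact: tdom_open.
    apply: (@smooth_on_ext _ _ _ _ (b * fun x => tmap t' (frame t i x) 0 j)) => //.
      by move=> z; rewrite inE => -[tz t'z]; rewrite /s asboolT// tmapZ// mxE.
    apply: smooth_onM => //; last exact: trivs_compatible.
    exact: (smooth_on_sub _ sb).
  exists (~` K `&` tdom t'); first by split=> // /KW.
  have oI : open (~` K `&` tdom t') by apply: openI; [exact: closed_openC|exact: tdom_open].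
  apply: smooth_on_ext (smooth_on_cst _ 0) => // z; rewrite inE => -[/bK bz t'z].
  by rewrite /s bz; case: asboolP => _; rewrite ?scale0r tmap0// mxE.
exists (\sum_i ((tmap t v 0 i / b x) *: Section_ (ss i))).
have sumE (I : finType) (F : I -> section E) : (\sum_i F i) x = \sum_i F i x.
  by apply: (big_rec2 (fun (a : section E) b => a x = b)) => // i a c _ <-.
rewrite sumE {2}(frame_expand v tx); apply: eq_bigr => i _ /=.
by rewrite /s asboolT// scalerA divfK.
Qed.

Variable C : courantAlgebroid E.
Local Notation g := (cmetric C).
Local Notation ip := (pairing (cmetric C)).

Lemma inner0 x (w : E x) : inner g 0 w = 0.
Proof.
apply: (addrI (inner g 0 w)).
by have := inner_linear g 1 0 0 w; rewrite scale1r mul1r !addr0 => <-.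
Qed.

Lemma innerD x (u v w : E x) : inner g (u + v) w = inner g u w + inner g v w.
Proof. by have := inner_linear g 1 u v w; rewrite scale1r mul1r. Qed.

Lemma innerZ x a (u w : E x) : inner g (a *: u) w = a * inner g u w.
Proof. by have := inner_linear g a u 0 w; rewrite !addr0 inner0 addr0. Qed.

Lemma innerN x (u w : E x) : inner g (- u) w = - inner g u w.
Proof. by rewrite -scaleN1r innerZ mulN1r. Qed.

Lemma innerB x (u v w : E x) : inner g (u - v) w = inner g u w - inner g v w.
Proof. by rewrite innerD innerN. Qed.

(** Used throughout to turn identities between sections into scalar identities. *)
Lemma inner_inj x (u v : E x) : (forall w, inner g u w = inner g v w) -> u = v.
Proof.
move=> uv; apply/eqP; rewrite -subr_eq0; apply/eqP/(inner_nondegenerate (m := g)) => w.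
by rewrite innerB uv subrr.
Qed.

Lemma inner_sum x (I : finType) (F : I -> E x) w :
  inner g (\sum_i F i) w = \sum_i inner g (F i) w.
Proof. by apply: (big_morph (fun u => inner g u w) (fun u v => innerD u v w) (inner0 w)). Qed.

Definition gram (t : trivialization E) x : 'M[R]_(trank t) :=
  \matrix_(i, j) inner g (frame t i x) (frame t j x).

(** A row [c] killed by the Gram matrix is the coordinate row of a vector orthogonal to the whole
    frame; nondegeneracy makes that vector 0, and its coordinates [c] vanish. *)
Lemma gram_unit (t : trivialization E) x : tdom t x -> gram t x \in unitmx.
Proof.
move=> tx; rewrite -row_free_unit -kermx_eq0; apply/eqP/row_matrixP => k; rewrite row0.
set c := row k _.
have cG : c *m gram t x = 0 by rewrite /c -row_mul mulmx_ker row0.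
clearbody c.
suff : \sum_i c 0 i *: frame t i x = 0 :> E x.
  move=> /(congr1 (tmap t (x := x))); rewrite tmap_sum// tmap0// => c0.
  rewrite [LHS]row_sum_delta -[RHS]c0; apply: eq_bigr => i _.
  by rewrite tmapZ// /frame tinvK.
apply/(inner_nondegenerate (m := g)) => w.
have l j : inner g (\sum_i c 0 i *: frame t i x) (frame t j x) = 0.
  transitivity ((c *m gram t x) 0 j); last by rewrite cG mxE.
  rewrite inner_sum mxE.
  by apply: eq_bigr => i _; rewrite innerZ mxE.
rewrite (frame_expand w tx) inner_sym inner_sum big1// => j _.
by rewrite innerZ inner_sym l mulr0.
Qed.

(** The vector representing the functional [phi] through the metric: its coordinates are the values
    of [phi] on the frame times the inverse Gram matrix. *)
Definition riesz (t : trivialization E) x (phi : E x -> R) : E x :=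
  \sum_j ((\row_i phi (frame t i x)) *m invmx (gram t x)) 0 j *: frame t j x.

Lemma inner_riesz (t : trivialization E) x (phi : E x -> R) : tdom t x ->
  (forall a u v, phi (a *: u + v) = a * phi u + phi v) ->
  forall w, inner g (riesz t phi) w = phi w.
Proof.
move=> tx phil w.
have phi0 : phi 0 = 0 by have := phil (-1) 0 0; rewrite scaler0 addr0 mulN1r addNr.
have phiD u v : phi (u + v) = phi u + phi v by rewrite -{1}[u]scale1r phil mul1r.
have phiZ a u : phi (a *: u) = a * phi u by rewrite -[_ *: _]addr0 phil phi0 addr0.
have l j : inner g (riesz t phi) (frame t j x) = phi (frame t j x).
  transitivity ((\row_i phi (frame t i x)) 0 j); last by rewrite mxE.
  rewrite -[\row_i _ in RHS](mulmxKV (gram_unit tx)) inner_sum [RHS]mxE.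
  by apply: eq_bigr => i _; rewrite innerZ [gram t x i j]mxE.
rewrite (frame_expand w tx) inner_sym inner_sum (big_morph phi phiD phi0).
by apply: eq_bigr => j _; rewrite innerZ inner_sym l phiZ.
Qed.

(** The representing vector is picked in each fibre with no reference to a trivialization, and its
    smoothness is read off the formula of [riesz] in each one. *)
Lemma calD_exists f : exists s : section E,
  forall (X : section E) x, ip s X x = anchor C (X x) f.
Proof.
pose s x : E x := xget 0 [set e | forall w, inner g e w = anchor C w f].
have sE x : forall w, inner g (s x) w = anchor C w f.
  apply: (@xgetPex _ 0 [set e | forall w, inner g e w = anchor C w f]).
  have [t tt tx] := trivs_cover E x.
  exists (riesz t (fun w => anchor C w f)); apply: inner_riesz => //.
  by move=> a u v; exact: anchor_linear.
have ss : smooth_section s.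
  move=> t tt j; have ot := tdom_open t.
  apply: (@smooth_on_ext _ _ _ _ (fun x =>
    \sum_i anchor C (frame t i x) f * invmx (gram t x) i j)) => //.
    move=> x; rewrite inE => tx.
    (* By nondegeneracy the chosen vector is unique, so it agrees with the explicit one for the
       given [t]. *)
    have -> : s x = riesz t (fun w => anchor C w f).
      apply: inner_inj => w; rewrite sE inner_riesz// => a u v.
      exact: anchor_linear.
    symmetry.
    rewrite /riesz tmap_sum// summxE [LHS](bigD1 j)//= [X in _ + X]big1 ?addr0; last first.
      by move=> k kj; rewrite tmapZ// /frame tinvK// !mxE eqxx eq_sym (negPf kj) mulr0.
    rewrite tmapZ// /frame tinvK// !mxE !eqxx mulr1.
    by apply: eq_bigr => i _; rewrite mxE.
  apply: smooth_on_sum => // i; apply: smooth_onM => //; first exact: anchor_smooth.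
  apply: smooth_on_invmx => // [x|k l]; first exact: gram_unit.
  apply: smooth_on_ext (inner_smooth g tt k l) => // x _.
  by rewrite mxE.
by exists (Section_ ss) => X x; exact: sE.
Qed.

Lemma inner_calD f x (v : E x) : inner g (calD C f x) v = anchor C v f.
Proof.
have [s sE] := calD_exists f; have [X <-] := section_extension v.
exact: (@xgetPex _ 0 [set s : section E | forall X x, ip s X x = anchor C (X x) f]
  (ex_intro _ s sE) X x).
Qed.

(** The Riesz vector of [w] mapped to the inner product of [A x w] with [e] shows that the set from
    which [transpose] picks is inhabited. *)
Lemma inner_transpose (A : forall x, E x -> E x) x (v e : E x) :
  linear (A x) -> inner g (A x v) e = inner g v (transpose C A e).
Proof.
move=> Al; have [t tt tx] := trivs_cover E x.
apply: (@xgetPex _ 0 [set e' | forall v, inner g (A x v) e = inner g v e']).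
exists (riesz t (fun w => inner g (A x w) e)) => w.
rewrite [RHS]inner_sym inner_riesz// => a u u'.
by rewrite Al inner_linear.
Qed.

End Sections.

(** * Richardson-Nijenhuis brackets with a grade-preserving one-form *)

Section FormDerivation.
Variables (R : fieldType) (V : lmodType R) (G : int -> set V).

(** Both lists of values are strictly sorted with the same members. This determines an unshuffle on
    a block from the image of that block. *)
Lemma eq_strict_mono (m : nat) (f g : 'I_m -> nat) :
  {homo f : i j / (i < j)%N} -> {homo g : i j / (i < j)%N} ->
  (forall i, exists j, f i = g j) -> (forall i, exists j, g i = f j) -> f =1 g.
Proof.
move=> fmono gmono fg gf i.
have sorted_map (h : 'I_m -> nat) : {homo h : i j / (i < j)%N} ->
    sorted ltn [seq h i | i <- enum 'I_m].
  move=> hmono; apply: (@homo_sorted _ _ h (fun i j => (i < j)%N)) => //.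
  by have := iota_ltn_sorted 0 m; rewrite -val_enum_ord sorted_map.
have efg : [seq f i | i <- enum 'I_m] = [seq g i | i <- enum 'I_m].
  apply: (irr_sorted_eq ltn_trans ltnn) => [||k]; [exact: sorted_map..|].
  by apply/mapP/mapP => -[j _ ->]; [have [l] := fg j|have [l] := gf j];
    exists l; rewrite ?mem_enum.
by move: (eq_in_map f g (enum 'I_m)).2 => /(_ efg); apply; rewrite mem_enum.
Qed.

Lemma unshuffle_size m (p : 'S_m) : unshuffle m p = (p == 1%g).
Proof.
apply/idP/eqP => [/forallP up|->]; last first.
  by apply/forallP => i; apply/forallP => j; rewrite !perm1; apply/implyP => /andP[].
apply/permP => i; rewrite perm1; apply/val_inj.
apply: (@eq_strict_mono m (fun i => val (p i)) val) => {i} [i j ij|i j //|i|i].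
- by have /forallP/(_ j) := up i; rewrite ij ltn_ord.
- by exists (p i).
- by exists ((p^-1)%g i); rewrite permKV.
Qed.

Lemma size_reorder (s : seq V) (p : 'S_(size s)) : size (reorder p) = size s.
Proof. by rewrite size_map size_enum_ord. Qed.

Lemma reorder1 (s : seq V) : reorder (1%g : 'S_(size s)) = s.
Proof.
apply: (@eq_from_nth _ 0); first exact: size_reorder.
move=> i; rewrite size_reorder => im.
rewrite (nth_map (Ordinal im)) ?size_enum_ord// perm1.
by rewrite nth_enum_ord.
Qed.

Lemma koszul1 (s : seq V) : koszul G (1%g : 'S_(size s)) = 1.
Proof.
apply: big1 => i _; apply: big1 => j; rewrite !perm1 => /andP[ij ji].
by have := ltn_trans ij ji; rewrite ltnn.
Qed.

(** The second block lists all values other than [p ord0] in increasing order, so the unshuffle is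
    known from [p ord0], and any value can occur there. *)
Lemma unshuffle_head m (p : 'S_m.+1) :
  unshuffle 1 p = (p == lift_perm ord0 (p ord0) 1).
Proof.
apply/idP/eqP => [/forallP up|->].
  apply/permP => i; case: (unliftP ord0 i) => [k|] ->; last by rewrite lift_perm_id.
  rewrite lift_perm_lift perm1; apply/val_inj; move: k.
  apply: (@eq_strict_mono m (fun k => val (p (lift ord0 k)))
            (fun k => val (lift (p ord0) k))) => [k l kl|k l kl|k|k].
  - have /forallP/(_ (lift ord0 l))/implyP := up (lift ord0 k); apply.
    by rewrite /= !ltnS kl.
  - by rewrite ltnNge leq_bump2 -ltnNge.
  - case: (unliftP (p ord0) (p (lift ord0 k))) => [l ->|/perm_inj]; first by exists l.
    by move/eqP; rewrite eq_sym (negPf (neq_lift _ _)).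
  - case: (unliftP ord0 ((p^-1)%g (lift (p ord0) k))) => [l e|e].
      by exists l; rewrite -e permKV.
    by have := congr1 p e; rewrite permKV => /eqP; rewrite eq_sym (negPf (neq_lift _ _)).
apply/forallP => i; apply/forallP => j; apply/implyP => /andP[].
case: (unliftP ord0 i) => [k ->|->]; case: (unliftP ord0 j) => [l ->|->//].
  by rewrite !lift_perm_lift !perm1 !ltnNge !leq_bump2 -!ltnNge.
by rewrite /= /bump.
Qed.

Lemma reorder_lift_perm (x : V) (s : seq V) (i : 'I_(size s).+1) :
  reorder (lift_perm ord0 i 1 : 'S_(size (x :: s))) =
  nth 0 (x :: s) i :: (take i (x :: s) ++ drop i.+1 (x :: s)).
Proof.
have iS : (i <= size s)%N by rewrite -ltnS ltn_ord.
rewrite /reorder enum_ordSl /= lift_perm_id -map_comp; congr cons.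
apply: (@eq_from_nth _ 0) => [|k].
  rewrite size_map size_enum_ord size_cat size_takel ?size_drop//=; last exact: ltnW.
  by rewrite subnKC.
rewrite size_map size_enum_ord => ks.
rewrite (nth_map (Ordinal ks)) ?size_enum_ord//= lift_perm_lift perm1.
rewrite nth_cat size_takel; last exact: ltnW.
rewrite /= /bump nth_enum_ord//; case: ltnP => ki; first by rewrite nth_take.
by rewrite nth_drop add1n /= subnKC.
Qed.

(** The only inversions pair the entry pulled to the front with the entries it passes. *)
Lemma koszul_lift_perm (x : V) (s : seq V) (i : 'I_(size s).+1) :
  koszul G (lift_perm ord0 i 1 : 'S_(size (x :: s))) =
  \prod_(y <- take i (x :: s))
    (-1) ^ (hdegree G (nth 0 (x :: s) i) * hdegree G y) :> R.
Proof.
rewrite /koszul big_ord_recl /= lift_perm_id [X in _ * X]big1 ?mulr1; last first.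
  move=> k _; apply: big1 => j /andP[].
  case: (unliftP ord0 j) => [l ->|->//].
  rewrite !lift_perm_lift !perm1 !ltnNge !leq_bump2 -!ltnNge => kl lk.
  by have := ltn_trans (kl : (k < l)%N) lk; rewrite ltnn.
rewrite big_mkcond big_ord_recl /= mul1r (big_nth 0) big_mkord.
have iS : (i <= size s)%N by rewrite -ltnS ltn_ord.
rewrite size_takel; last exact: ltnW.
rewrite -big_mkcond /=.
rewrite (eq_bigl (fun k : 'I_(size s) => (k < i)%N)); last first.
  by move=> k; rewrite lift_perm_lift perm1 /= /bump /=; case: leqP; lia.
rewrite (eq_bigr (fun k : 'I_(size s) => (-1) ^ (hdegree G (nth 0 (x :: s) i) *
  hdegree G (nth 0 (x :: s) k)))); last first.
  by move=> k ki; rewrite lift_perm_lift perm1 /= /bump leqNgt ki.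
rewrite (big_ord_narrow iS); apply: eq_bigr => k _ /=.
by rewrite nth_take.
Qed.

(* Recursion on the list, rather than a sum over positions, so that it splits
   along concatenations. *)
Fixpoint sum_apply (phi : V -> V) (L : vvform V) (s : seq V) : V :=
  if s is x :: s' then L (phi x :: s') + sum_apply phi (fun t => L (x :: t)) s'
  else 0.

Lemma sum_applyE phi L s :
  sum_apply phi L s =
  \sum_(i < size s) L (take i s ++ phi (nth 0 s i) :: drop i.+1 s).
Proof.
elim: s L => [|x s IH] L; first by rewrite big_ord0.
by rewrite /= IH big_ord_recl /= drop0.
Qed.

Lemma eq_sum_apply phi L L' s : L =1 L' -> sum_apply phi L s = sum_apply phi L' s.
Proof.
elim: s L L' => //= x s IH L L' e; rewrite e; congr (_ + _).
by apply: IH => t; rewrite e.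
Qed.

Lemma sum_apply_scale phi a L s :
  sum_apply phi (fun t => a *: L t) s = a *: sum_apply phi L s.
Proof.
elim: s L => [|x s IH] L /=; first by rewrite scaler0.
by rewrite IH scalerDr.
Qed.

Lemma sum_apply_cat phi L s1 s2 : sum_apply phi L (s1 ++ s2) =
  sum_apply phi (fun t => L (t ++ s2)) s1 + sum_apply phi (fun t => L (s1 ++ t)) s2.
Proof.
elim: s1 L => [|x s1 IH] L /=; first by rewrite add0r.
by rewrite IH addrA.
Qed.

(** The consequence of multilinearity that discards the terms of an insertion in which
    [one_form phi], given a number of arguments other than one, returns 0. *)
Definition vanishing (L : vvform V) := forall s1 s2, L (s1 ++ 0 :: s2) = 0.

Definition graded_symmetric (L : vvform V) := forall s1 s2 i j x y, G i x -> G j y ->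
  L (s1 ++ x :: y :: s2) = (-1) ^ (i * j) *: L (s1 ++ y :: x :: s2).

Lemma form_of_degree_vanishing d L : form_of_degree G d L -> vanishing L.
Proof.
case=> + _ _ => /(_ _ _ 1 0 0) lin s1 s2; have := lin s1 s2.
by rewrite scaler0 addr0 scale1r => /eqP; rewrite addrC -subr_eq subrr eq_sym => /eqP.
Qed.

Lemma homogeneous_hdegree x : homogeneous G x -> G (hdegree G x) x.
Proof. by move=> [i Gi]; apply: (@xgetPex _ 0 [set i | G i x]); exists i. Qed.

Variable phi : V -> V.
Hypothesis phiZ : forall a x, phi (a *: x) = a *: phi x.
Hypothesis phiG : forall i x, G i x -> G i (phi x).

(* Cancels the Koszul sign of an unshuffle that brings one entry to the front. *)
Lemma graded_symmetric_move L s1 s2 i y : graded_symmetric L -> G i y ->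
  (forall z, z \in s1 -> homogeneous G z) ->
  (\prod_(z <- s1) (-1) ^ (i * hdegree G z)) *: L (y :: s1 ++ s2) =
  L (s1 ++ y :: s2).
Proof.
move=> Lsym Gy; elim: s1 L Lsym => [|x s1 IH] L Lsym hs; first by rewrite big_nil scale1r.
rewrite big_cons mulrC -scalerA /=.
have Gx : G (hdegree G x) x by apply/homogeneous_hdegree/hs; rewrite mem_head.
have <- : L (x :: y :: s1 ++ s2) =
    (-1) ^ (i * hdegree G x) *: L (y :: x :: s1 ++ s2).
  by rewrite mulrC; exact: (Lsym [::]).
rewrite (IH (fun t => L (x :: t)))// => [s1' s2' *|z zs]; first exact: (Lsym (x :: s1')).
by apply: hs; rewrite inE zs orbT.
Qed.

(** The unshuffles with first block of size 1 are indexed by the entry they pull out. As [phi]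
    preserves degrees, graded symmetry of [L] moves the image back to its place with exactly the
    Koszul sign. *)
Lemma insertion_one_form L s : vanishing L -> graded_symmetric L ->
  (forall x, x \in s -> homogeneous G x) ->
  insertion G (one_form phi) L s = sum_apply phi L s.
Proof.
move=> L0 Lsym; case: s => [|x s] hs.
  by rewrite /insertion big_ord1 big1// => p _; rewrite take0 [L _](L0 [::]) scaler0.
(* Only [k = 1] contributes: any other block size feeds 0 into [L]. *)
rewrite sum_applyE /insertion (bigD1 (inord 1)) //= [X in _ + X]big1 ?addr0; last first.
  move=> k k1; apply: big1 => p _.
  suff -> : one_form phi (take k (@reorder _ _ (x :: s) p)) = 0 by rewrite [L _](L0 [::]) scaler0.
  have : size (take k (@reorder _ _ (x :: s) p)) != 1%N.
    rewrite size_takel ?(@size_reorder (x :: s)) -1?ltnS//.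
    by apply: contra k1 => /eqP e; apply/eqP/val_inj; rewrite /= inordK.
  case: (take k (@reorder _ _ (x :: s) p)) => [|? []] //=.
rewrite inordK// (reindex_onto (fun i : 'I_(size s).+1 => lift_perm ord0 i 1 : 'S_(size s).+1)
  (fun p => p ord0)) /=; last by move=> p; rewrite unshuffle_head => /eqP <-.
apply: eq_big => [i|i _]; first by rewrite unshuffle_head lift_perm_id !eqxx.
rewrite reorder_lift_perm koszul_lift_perm [take 1 _]/= take0 [drop 1 _]/= drop0 [one_form _ _]/=.
have xi : homogeneous G (nth 0 (x :: s) i) by apply: hs; exact: mem_nth.
apply: graded_symmetric_move => //; first exact/phiG/homogeneous_hdegree.
by move=> z /mem_take; exact: hs.
Qed.

(** A nonempty second block gives [one_form phi] at least two arguments, hence 0; with the full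
    first block only the identity is an unshuffle. *)
Lemma insertion_in_one_form K s : insertion G K (one_form phi) s = phi (K s).
Proof.
rewrite /insertion big_ord_recr /= [X in X + _]big1 ?add0r; last first.
  move=> k _; apply: big1 => p _.
  have : size (drop k (reorder p)) != 0%N.
    by rewrite size_drop size_reorder subn_eq0 -ltnNge.
  by case: (drop k (reorder p)) => //=; rewrite scaler0.
rewrite (eq_bigl (pred1 1%g)) => [|p]; last exact: unshuffle_size.
by rewrite big_pred1_eq koszul1 reorder1 scale1r take_size drop_size.
Qed.

Definition derivation L : vvform V := fun s => sum_apply phi L s - phi (L s).

Lemma bracketRN_one_form d L s : vanishing L -> graded_symmetric L ->
  (forall x, x \in s -> homogeneous G x) ->
  bracketRN G 0 d (one_form phi) L s = derivation L s.
Proof.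
move=> L0 Lsym hs.
by rewrite /bracketRN insertion_one_form// insertion_in_one_form mul0r expr0z scale1r.
Qed.

Let phi0 : phi 0 = 0. Proof. by have := phiZ 0 0; rewrite !scale0r. Qed.

Lemma vanishing_derivation L : vanishing L -> vanishing (derivation L).
Proof.
move=> L0 s1 s2; rewrite /derivation L0 phi0 subr0 sum_apply_cat /= phi0 L0 add0r.
have z (s : seq V) L' : (forall t, L' t = 0) -> sum_apply phi L' s = 0.
  by elim: s L' => //= x s IH L' e; rewrite e add0r IH.
by rewrite !z ?addr0// => t; exact: L0.
Qed.

Lemma graded_symmetric_derivation L :
  graded_symmetric L -> graded_symmetric (derivation L).
Proof.
move=> Lsym s1 s2 i j x y Gx Gy.
rewrite /derivation (Lsym _ _ i j)// phiZ scalerBr; congr (_ - _).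
rewrite !sum_apply_cat /= !scalerDr -!sum_apply_scale; congr (_ + _).
  by apply: eq_sum_apply => t; exact: Lsym.
rewrite (Lsym _ _ i j)//; last exact: phiG.
(* The terms with [phi] on [x] and with [phi] on [y] trade places under the swap. *)
rewrite addrCA (Lsym _ _ i j)//; last exact: phiG.
by congr (_ + (_ + _)); apply: eq_sum_apply => t; exact: Lsym.
Qed.

Lemma reorder_homogeneous s (p : 'S_(size s)) :
  (forall x, x \in s -> homogeneous G x) ->
  forall x, x \in reorder p -> homogeneous G x.
Proof. by move=> hs x /mapP[i _ ->]; apply/hs/mem_nth. Qed.

(** [form_eq] compares forms on homogeneous lists only, so the inserted value, [phi y] or 0, has to
    be homogeneous. This allows the inner bracket of a double bracket to be replaced by a
    derivation. *)
Lemma eq_insertion_one_form L L' s : homogeneous G 0 -> form_eq G L L' ->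
  (forall x, x \in s -> homogeneous G x) ->
  insertion G (one_form phi) L s = insertion G (one_form phi) L' s.
Proof.
move=> G0 LL' hs; apply: eq_bigr => k _; apply: eq_bigr => p _; congr (_ *: _).
have hr := reorder_homogeneous (p := p) hs.
apply: LL' => x; rewrite inE => /predU1P[->|/mem_drop]; last exact: hr.
case e : (take k (reorder p)) => [|y [|? ?]] //=.
have [i Gi] : homogeneous G y.
  by have : y \in take k (reorder p); [rewrite e mem_head|move/mem_take/hr].
by exists i; exact: phiG.
Qed.

Lemma bracketRN_one_form2 L s : homogeneous G 0 ->
  vanishing L -> graded_symmetric L -> (forall x, x \in s -> homogeneous G x) ->
  bracketRN G 0 1 (one_form phi) (bracketRN G 0 1 (one_form phi) L) s =
  derivation (derivation L) s.
Proof.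
move=> G0 L0 Lsym hs.
set B := bracketRN G 0 1 (one_form phi) L.
have e : form_eq G B (derivation L).
  by move=> t; exact: bracketRN_one_form.
rewrite /bracketRN (eq_insertion_one_form G0 e hs) insertion_in_one_form e//.
rewrite insertion_one_form// ?mul0r ?expr0z ?scale1r//.
- exact: vanishing_derivation.
- exact: graded_symmetric_derivation.
Qed.

End FormDerivation.

(** * The Lie 2-algebra structure is a vector valued form of degree 1 *)

Section Lie2Algebra.
Variables (R : realType) (n : nat) (M : manifold R n) (E : vectorBundle M).
Variable C : courantAlgebroid E.

Local Notation "X ** Y" := (dorfman C X Y) (at level 40).
Local Notation g := (cmetric C).
Local Notation ip := (pairing (cmetric C)).
Local Notation V := (lie2_space E).
Local Notation G := (@lie2_grading R n M E).

Lemma smoothFun_ext (f h : smoothFun M) : (forall x, f x = h x) -> f = h.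
Proof. by move=> fh; apply/val_inj/funext. Qed.

Lemma smooth_funD (f h : smoothFun M) x : (f + h) x = f x + h x. Proof. by []. Qed.
Lemma smooth_funN (f : smoothFun M) x : (- f) x = - f x. Proof. by []. Qed.
Lemma smooth_funM (f h : smoothFun M) x : (f * h) x = f x * h x. Proof. by []. Qed.
Lemma smooth_funZ a (f : smoothFun M) x : (a *: f) x = a * f x. Proof. by []. Qed.
Lemma smooth_fun0 x : (0 : smoothFun M) x = 0. Proof. by []. Qed.
Lemma sectionD (X Y : section E) x : (X + Y) x = X x + Y x. Proof. by []. Qed.
Lemma sectionN (X : section E) x : (- X) x = - X x. Proof. by []. Qed.
Lemma sectionZ a (X : section E) x : (a *: X) x = a *: X x. Proof. by []. Qed.

Definition pointwiseE := (smooth_funD, smooth_funN, smooth_funM, smooth_funZ,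
  smooth_fun0, sectionD, sectionN, sectionZ).

Lemma ip_calD X f x : ip X (calD C f) x = anchor C (X x) f.
Proof. by rewrite -inner_calD inner_sym. Qed.

(** In the Leibniz rule the term differentiating [f] vanishes; extending [v] to a section makes the
    Casimir condition applicable. *)
Lemma anchor_casimir x (v : E x) f h : casimir C f ->
  anchor C v (f * h) = f x * anchor C v h.
Proof.
move=> cf; have [X <-] := section_extension v.
by rewrite tangent_leibniz cf mulr0 addr0.
Qed.

Lemma calD_linear a f h : calD C (a *: f + h) = a *: calD C f + calD C h.
Proof.
apply: section_ext => x; apply: (inner_inj (C := C)) => w.
by rewrite !pointwiseE innerD innerZ !inner_calD tangent_linear.
Qed.

Lemma calD0 : calD C 0 = 0.
Proof.
by have := calD_linear (-1) 0 0; rewrite scaler0 addr0 scaleN1r addNr.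
Qed.

Lemma calD_casimir f h : casimir C f -> calD C (f * h) = fscale f (calD C h).
Proof.
move=> cf; apply: section_ext => x; apply: (inner_inj (C := C)) => w.
by rewrite /= innerZ !inner_calD anchor_casimir.
Qed.

Lemma dorfman0l X : 0 ** X = 0.
Proof.
by have := dorfman_linearl C (-1) 0 0 X; rewrite scaler0 addr0 scaleN1r addNr.
Qed.

Lemma dorfman0r X : X ** 0 = 0.
Proof.
by have := dorfman_linearr C (-1) X 0 0; rewrite scaler0 addr0 scaleN1r addNr.
Qed.

Lemma l1_linear a (u v : V) : l1 C (a *: u + v) = a *: l1 C u + l1 C v.
Proof.
rewrite /l1 /= calD_linear; congr pair.
by rewrite /= scaler0 addr0.
Qed.

Lemma l2_linearl a (u v w : V) : l2 C (a *: u + v) w = a *: l2 C u w + l2 C v w.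
Proof.
congr pair => /=.
  apply: smoothFun_ext => x; rewrite !pointwiseE !ip_calD /= anchor_linear tangent_linear.
  ring.
rewrite dorfman_linearl dorfman_linearr scalerA mulrC -scalerA -scalerDr.
by congr (_ *: _); rewrite opprD addrACA scalerBr.
Qed.

Lemma l2_linearr a (u v w : V) : l2 C w (a *: u + v) = a *: l2 C w u + l2 C w v.
Proof.
congr pair => /=.
  apply: smoothFun_ext => x; rewrite !pointwiseE !ip_calD /= anchor_linear tangent_linear.
  ring.
rewrite dorfman_linearl dorfman_linearr scalerA mulrC -scalerA -scalerDr.
by congr (_ *: _); rewrite opprD addrACA scalerBr.
Qed.

(** Twelve times one cyclic term of [l3], evaluated at [x]. *)
Definition skew_pairing x (X Y Z : section E) : R := ip (X ** Y - Y ** X) Z x.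

Lemma skew_pairing_linear1 x a (X X' Y Z : section E) :
  skew_pairing x (a *: X + X') Y Z = a * skew_pairing x X Y Z + skew_pairing x X' Y Z.
Proof.
rewrite /skew_pairing dorfman_linearl dorfman_linearr /= !(innerD, innerN, innerZ).
ring.
Qed.

Lemma skew_pairing_anti x X Y Z : skew_pairing x Y X Z = - skew_pairing x X Y Z.
Proof. by rewrite /skew_pairing /= !innerB opprB. Qed.

Lemma skew_pairing_linear2 x a (X Y Y' Z : section E) :
  skew_pairing x X (a *: Y + Y') Z = a * skew_pairing x X Y Z + skew_pairing x X Y' Z.
Proof. by rewrite !(skew_pairing_anti _ _ X) skew_pairing_linear1 opprD mulrN. Qed.

Lemma skew_pairing_linear3 x a (X Y Z Z' : section E) :
  skew_pairing x X Y (a *: Z + Z') = a * skew_pairing x X Y Z + skew_pairing x X Y Z'.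
Proof.
rewrite /skew_pairing /= inner_sym inner_linear.
by congr (_ * _ + _); exact: inner_sym.
Qed.

Definition cyclic_pairing (X Y Z : section E) : smoothFun M :=
  12^-1 *: ip (X ** Y - Y ** X) Z + 12^-1 *: ip (Y ** Z - Z ** Y) X +
  12^-1 *: ip (Z ** X - X ** Z) Y.

Lemma cyclic_pairingE X Y Z x : cyclic_pairing X Y Z x =
  12^-1 * (skew_pairing x X Y Z + skew_pairing x Y Z X + skew_pairing x Z X Y).
Proof. by rewrite !mulrDr. Qed.

Lemma l3E (u v w : V) : l3 C u v w = (cyclic_pairing u.2 v.2 w.2, 0).
Proof. by []. Qed.

(** Brings any argument to the first slot, so that linearity and antisymmetry need proof in one
    position only. *)
Lemma l3_cycle (u v w : V) : l3 C v w u = l3 C u v w.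
Proof.
rewrite !l3E; congr pair; apply: smoothFun_ext => x; rewrite !cyclic_pairingE; ring.
Qed.

Lemma l3_linear a (u u' v w : V) : l3 C (a *: u + u') v w = a *: l3 C u v w + l3 C u' v w.
Proof.
rewrite !l3E; congr pair; last by rewrite /= scaler0 addr0.
rewrite -[LHS]/(cyclic_pairing (a *: u.2 + u'.2) v.2 w.2).
rewrite -[RHS]/(a *: cyclic_pairing u.2 v.2 w.2 + cyclic_pairing u'.2 v.2 w.2).
apply: smoothFun_ext => x.
rewrite [RHS]smooth_funD [X in _ = X + _]smooth_funZ !cyclic_pairingE.
rewrite skew_pairing_linear1 skew_pairing_linear2 skew_pairing_linear3.
ring.
Qed.

Lemma l3_anti (u v w : V) : l3 C v u w = - l3 C u v w.
Proof.
rewrite !l3E; congr pair; last by rewrite /= oppr0.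
rewrite -[RHS]/(- cyclic_pairing u.2 v.2 w.2).
apply: smoothFun_ext => x; rewrite [RHS]smooth_funN !cyclic_pairingE.
rewrite (skew_pairing_anti _ u.2) (skew_pairing_anti _ w.2 u.2).
by rewrite (skew_pairing_anti _ v.2 w.2); ring.
Qed.

Lemma l3_eq0 (u v w : V) : [\/ u.2 = 0, v.2 = 0 | w.2 = 0] -> l3 C u v w = 0.
Proof.
have l3_0 (a b c : V) : a.2 = 0 -> l3 C a b c = 0.
  move=> a0; have -> : l3 C a b c = l3 C 0 b c by rewrite /l3 a0.
  by have := l3_linear (-1) 0 0 b c; rewrite scaler0 addr0 scaleN1r addNr.
case=> z; first exact: l3_0.
  by rewrite -l3_cycle l3_0.
by rewrite l3_cycle l3_0.
Qed.

Lemma l2_0l (u : V) : l2 C 0 u = 0.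
Proof. by have := l2_linearl (-1) 0 0 u; rewrite scaler0 addr0 scaleN1r addNr. Qed.

Lemma l2_0r (u : V) : l2 C u 0 = 0.
Proof. by have := l2_linearr (-1) 0 0 u; rewrite scaler0 addr0 scaleN1r addNr. Qed.

Lemma l1_eq0 (u : V) : u.1 = 0 -> l1 C u = 0.
Proof. by rewrite /l1 => ->; rewrite calD0. Qed.

Lemma ip0 (X : section E) : ip X 0 = 0.
Proof. by apply: smoothFun_ext => x; rewrite /= inner_sym inner0. Qed.

Lemma ip0l (X : section E) : ip 0 X = 0.
Proof. by apply: smoothFun_ext => x; rewrite /= inner0. Qed.

Lemma l2_sym (u v : V) : u.2 = 0 \/ v.2 = 0 -> l2 C u v = l2 C v u.
Proof.
rewrite /l2; case=> ->; rewrite !dorfman0l !dorfman0r subrr; congr pair; exact: addrC.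
Qed.

Lemma l2_anti (u v : V) : u.1 = 0 -> v.1 = 0 -> l2 C u v = - l2 C v u.
Proof.
move=> u0 v0; rewrite /l2 u0 v0 calD0 !ip0 !scaler0 addr0; congr pair.
  by rewrite oppr0.
by rewrite -[RHS]/(- (2^-1 *: _)) -scalerN opprB.
Qed.

Lemma grading_cases i (u : V) : G i u ->
  [\/ i = - 2 /\ u.2 = 0, i = - 1 /\ u.1 = 0 | u = 0].
Proof.
rewrite /lie2_grading /=; case: eqP => [->|_]; first by constructor 1.
by case: eqP => [->|_]; [constructor 2|constructor 3].
Qed.

Lemma grading0 i : G i 0.
Proof. by rewrite /lie2_grading /=; do 2 case: ifP => // _. Qed.

Lemma lie2_structure_multilinear s1 s2 a (u v : V) :
  lie2_structure C (s1 ++ (a *: u + v) :: s2) =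
  a *: lie2_structure C (s1 ++ u :: s2) + lie2_structure C (s1 ++ v :: s2).
Proof.
case: s1 => [|p [|q [|r [|r' s1]]]].
- case: s2 => [|p [|q [|r s2]]] /=; [exact: l1_linear|exact: l2_linearl|exact: l3_linear|].
  by rewrite scaler0 addr0.
- case: s2 => [|q [|r s2]] /=; [exact: l2_linearr|by rewrite -!(l3_cycle p) l3_linear|].
  by rewrite scaler0 addr0.
- case: s2 => [|r s2] /=; [by rewrite !(l3_cycle _ p) l3_linear|].
  by rewrite scaler0 addr0.
- by rewrite /= scaler0 addr0.
- by rewrite /= scaler0 addr0.
Qed.

Lemma lie2_structure_vanishing s1 s2 : lie2_structure C (s1 ++ 0 :: s2) = 0.
Proof.
have := lie2_structure_multilinear s1 s2 (-1) 0 0.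
by rewrite scaler0 addr0 scaleN1r addNr.
Qed.

(** The sign is -1 only for two sections, where [l2] and [l3] are antisymmetric. Otherwise an
    argument is a function, of even degree, or is 0. *)
Lemma lie2_structure_graded_symmetric s1 s2 i j (u v : V) : G i u -> G j v ->
  lie2_structure C (s1 ++ u :: v :: s2) =
  (-1) ^ (i * j) *: lie2_structure C (s1 ++ v :: u :: s2).
Proof.
move=> Gu Gv.
have sym : u.2 = 0 \/ v.2 = 0 ->
    lie2_structure C (s1 ++ u :: v :: s2) = lie2_structure C (s1 ++ v :: u :: s2).
  move=> uv; case: s1 => [|p [|q s1]].
  - case: s2 => [|p [|q s2]] //=; first exact: l2_sym.
    by rewrite !l3_eq0//; case: uv => ->; [constructor 2|constructor 1|constructor 1|constructor 2].
  - case: s2 => [|q s2] //=.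
    by rewrite !l3_eq0//; case: uv => ->; [constructor 3|constructor 2|constructor 2|constructor 3].
  - by case: s1 => [|? [|? ?]].
have {}sym : u.2 = 0 \/ v.2 = 0 -> ((-1) ^ (i * j) : R) = 1 \/ u = 0 \/ v = 0 ->
    lie2_structure C (s1 ++ u :: v :: s2) =
    (-1) ^ (i * j) *: lie2_structure C (s1 ++ v :: u :: s2).
  move=> /sym -> [->|]; first by rewrite scale1r.
  have c0 (p q : V) : p = 0 \/ q = 0 -> lie2_structure C (s1 ++ p :: q :: s2) = 0.
    by case=> ->; rewrite ?lie2_structure_vanishing// -cat_rcons lie2_structure_vanishing.
  by move=> uv; rewrite c0 ?scaler0//; case: uv; [right|left].
have m2 (k : int) : ((-1) ^ (- 2 * k) : R) = 1
  by rewrite mulNr -exprz_inv invrN1 -exprz_exp -[2]/(Posz 2) -exprnP sqrrN expr1n exp1rz.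
case: (grading_cases Gu) => [[iE u0]|[iE u0]|u0].
- by apply: sym; left => //; rewrite iE.
- case: (grading_cases Gv) => [[jE v0]|[jE v0]|v0].
  + by apply: sym; [right|left; rewrite jE mulrC].
  + have -> : (-1) ^ (i * j) = -1 :> R by rewrite iE jE.
    rewrite scaleN1r; clear sym; case: s1 => [|p [|q s1]].
    * case: s2 => [|p [|q s2]] /=; [exact: l2_anti|exact: l3_anti|by rewrite oppr0].
    * case: s2 => [|q s2] /=; last by rewrite oppr0.
      by rewrite -!(l3_cycle p) l3_anti.
    * by case: s1 => [|? [|? ?]] /=; rewrite oppr0.
  + by apply: sym; right; rewrite ?v0; [|right].
- by apply: sym; [left; rewrite u0|right; left].
Qed.

Lemma lie2_structure_degree (s : seq V) (ds : seq int) : size ds = size s ->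
  (forall k, (k < size s)%N -> G (nth 0 ds k) (nth 0 s k)) ->
  G (\sum_(i <- ds) i + 1) (lie2_structure C s).
Proof.
case: s => [|u [|v [|w [|t s]]]] sz Gs; try exact: grading0.
- case: ds sz Gs => [|i []] //= _ /(_ 0 isT) /= Gu; rewrite big_seq1.
  case: (grading_cases Gu) => [[-> u0]|[-> u0]|u0] //; last first.
    by rewrite l1_eq0 ?u0; first exact: grading0.
  by rewrite l1_eq0//; exact: grading0.
- case: ds sz Gs => [|i [|j []]] //= _ Gs; rewrite big_cons big_seq1.
  have := (Gs 0 isT, Gs 1 isT) => /= -[Gu Gv].
  case: (grading_cases Gu) => [[-> u0]|[-> u0]|->]; last by rewrite l2_0l; exact: grading0.
    case: (grading_cases Gv) => [[-> v0]|[-> v0]|->]; last by rewrite l2_0r; exact: grading0.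
      (* Two functions would land in degree -2 - 2 + 1 = -3, which contains only 0. *)
      have -> : l2 C u v = 0.
        by rewrite /l2 u0 v0 !ip0l dorfman0l subrr !scaler0 addr0.
      exact: grading0.
    suff : (l2 C u v).2 = 0 by [].
    by rewrite /= u0 dorfman0l dorfman0r subrr scaler0.
  case: (grading_cases Gv) => [[-> v0]|[-> v0]|->]; last by rewrite l2_0r; exact: grading0.
    suff : (l2 C u v).2 = 0 by [].
    by rewrite /= v0 dorfman0l dorfman0r subrr scaler0.
  suff : (l2 C u v).1 = 0 by [].
  by rewrite /= u0 v0 calD0 !ip0 !scaler0 addr0.
- case: ds sz Gs => [|i [|j [|k []]]] //= _ Gs; rewrite !big_cons big_nil.
  have := (Gs 0 isT, Gs 1 isT, Gs 2 isT) => /= -[[Gu Gv] Gw].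
  case: (grading_cases Gu) => [[_ u0]|[-> u0]|u0];
    try by rewrite l3_eq0 ?u0; [exact: grading0|constructor 1].
  case: (grading_cases Gv) => [[_ v0]|[-> v0]|v0];
    try by rewrite l3_eq0 ?v0; [exact: grading0|constructor 2].
  case: (grading_cases Gw) => [[_ w0]|[-> w0]|w0];
    try by rewrite l3_eq0 ?w0; [exact: grading0|constructor 3].
  by [].
Qed.

Lemma lie2_structure_form : form_of_degree G 1 (lie2_structure C).
Proof.
split; [exact: lie2_structure_multilinear|exact: lie2_structure_graded_symmetric|].
exact: lie2_structure_degree.
Qed.

End Lie2Algebra.

(** * One-forms of degree 0, and derivations on short lists *)

Section OneForms.
Variables (R : fieldType) (V : lmodType R) (G : int -> set V) (phi : V -> V).

Lemma one_form_degree0 : (forall i, G i 0) -> linear phi ->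
  (forall i x, G i x -> G i (phi x)) -> form_of_degree G 0 (one_form phi).
Proof.
move=> G0 lphi Gphi; split.
- case=> [|p s1] [|q s2] a x y /=; rewrite ?scaler0 ?addr0//; first exact: lphi.
    by case: s1 => [|? ?] /=; rewrite scaler0 addr0.
  by case: s1 => [|? ?] /=; rewrite scaler0 addr0.
- case=> [|p s1] s2 i j x y _ _ /=; first by rewrite scaler0.
  by case: s1 => [|? ?] /=; rewrite scaler0.
- move=> [|x [|y s]] ds sz Gs; try exact: G0.
  case: ds sz Gs => [|i []] //= _ /(_ 0 isT) /= Gx.
  by rewrite big_seq1 addr0; exact: Gphi.
Qed.

Lemma derivation1E L u : derivation phi L [:: u] = L [:: phi u] - phi (L [:: u]).
Proof. by rewrite /derivation /= addr0. Qed.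

Lemma derivation2E L u v : derivation phi L [:: u; v] =
  L [:: phi u; v] + L [:: u; phi v] - phi (L [:: u; v]).
Proof. by rewrite /derivation /= addr0. Qed.

Lemma derivation3E L u v w : derivation phi L [:: u; v; w] =
  L [:: phi u; v; w] + L [:: u; phi v; w] + L [:: u; v; phi w] - phi (L [:: u; v; w]).
Proof. by rewrite /derivation /= addr0 !addrA. Qed.

(** A derivation keeps the number of arguments; this disposes of the lengths in which a form has no
    component. *)
Lemma derivation_eq0 L s : phi 0 = 0 -> (forall t, size t = size s -> L t = 0) ->
  derivation phi L s = 0.
Proof.
move=> phi0 Ls; rewrite /derivation Ls// phi0 subr0.
elim: s L Ls => //= x s IH L Ls; rewrite Ls//= add0r IH// => t ts.
by rewrite Ls//= ts.
Qed.

End OneForms.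

(** * Algebra of the tensor [N], and the Nijenhuis condition on [l1], [l2] and [l3] *)

Section NijenhuisTensor.
Variables (R : realType) (n : nat) (M : manifold R n) (E : vectorBundle M).
Variables (C : courantAlgebroid E) (N : bundleEndo E) (lam gam : smoothFun M).

Local Notation "X ** Y" := (dorfman C X Y) (at level 40).
Local Notation g := (cmetric C).
Local Notation ip := (pairing (cmetric C)).
Local Notation V := (lie2_space E).
Local Notation G := (@lie2_grading R n M E).
Local Notation NS := (endo_section N).

Hypothesis hT : forall X Y : section E, torsion C N X Y = 0.
Hypothesis hlam : casimir C lam.
Hypothesis hgam : casimir C gam.
Hypothesis hN : forall (X : section E) (x : M),
  endo N x (X x) + transpose C (endo N) (X x) = lam x *: X x.
Hypothesis hN2 : forall (X : section E) (x : M),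
  endo N x (endo N x (X x)) +
  transpose C (fun y e => endo N y (endo N y e)) (X x) = gam x *: X x.

Lemma endoZ x a (u : E x) : endo N x (a *: u) = a *: endo N x u.
Proof.
have N0 : endo N x 0 = 0.
  by have := @endo_linear _ _ _ _ N x (-1) 0 0; rewrite scaler0 addr0 scaleN1r addNr.
by have := @endo_linear _ _ _ _ N x a u 0; rewrite N0 !addr0.
Qed.

Lemma endoD x (u v : E x) : endo N x (u + v) = endo N x u + endo N x v.
Proof. by have := @endo_linear _ _ _ _ N x 1 u v; rewrite !scale1r. Qed.

Lemma endoN x (u : E x) : endo N x (- u) = - endo N x u.
Proof. by rewrite -scaleN1r endoZ scaleN1r. Qed.

Lemma endo2_linear x : linear (fun e : E x => endo N x (endo N x e)).
Proof. by move=> a u v; rewrite !(endoD, endoZ). Qed.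

Lemma inner_endo x (v e : E x) :
  inner g (endo N x v) e = lam x * inner g v e - inner g v (endo N x e).
Proof.
have [X <-] := section_extension e.
rewrite (@inner_transpose _ _ _ _ C (endo N)); last exact: endo_linear.
(* The transpose at e is written as -Ne + (Ne + N^* e), which exposes the left side of [hN]. *)
rewrite inner_sym -[transpose _ _ _](addKr (endo N x (X x))) hN innerD innerN innerZ.
by rewrite addrC !(inner_sym _ v).
Qed.

(** The condition on N^2 gives the sum of the products of N^2 v with e and of v with N^2 e; two uses
    of [inner_endo] give their difference. The formula is half the total. *)
Lemma inner_endo2 x (v e : E x) : inner g (endo N x (endo N x v)) e =
  lam x * inner g (endo N x v) e + 2^-1 * (gam x - lam x ^+ 2) * inner g v e.
Proof.
have h : inner g (endo N x (endo N x v)) e =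
    gam x * inner g v e - inner g v (endo N x (endo N x e)).
  have [X <-] := section_extension e.
  rewrite (@inner_transpose _ _ _ _ C (fun y e => endo N y (endo N y e))); last exact: endo2_linear.
  rewrite inner_sym -[transpose _ _ _](addKr (endo N x (endo N x (X x)))) hN2.
  by rewrite innerD innerN innerZ addrC !(inner_sym _ v).
have h1 := inner_endo (endo N x v) e.
have h2 := inner_endo v (endo N x e).
have h3 := inner_endo v e.
by rewrite h1 h2 h3 in h *; lra.
Qed.

Lemma endo2E (X : section E) :
  NS (NS X) = fscale lam (NS X) + fscale (2^-1 *: (gam - lam ^+ 2)) X.
Proof.
apply: section_ext => x; apply: (inner_inj (C := C)) => w.
by rewrite inner_endo2 -!innerZ -innerD.
Qed.

Lemma smooth_fun_mul_linear (f : smoothFun M) : linear ( *%R f).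
Proof. by move=> a p q; apply: smoothFun_ext => x; rewrite !(pointwiseE E); ring. Qed.

(** Common shape of the two one-forms of the theorem, with [A] the tensor or its square. *)
Definition lie2_map (f : smoothFun M) (A : section E -> section E) : V -> V :=
  fun u => (f * u.1, A u.2).

Lemma lie2_map_linear f A : linear A -> linear (lie2_map f A).
Proof.
move=> lA a u v; congr pair; last exact: lA.
exact: smooth_fun_mul_linear.
Qed.

Lemma lie2_map_degree f A : linear A ->
  forall i u, G i u -> G i (lie2_map f A u).
Proof.
move=> lA i u /grading_cases.
have A0 : A 0 = 0 by have := lA (-1) 0 0; rewrite scaler0 addr0 scaleN1r addNr.
case=> [[-> u0]|[-> u0]|->].
- by rewrite /lie2_grading /= u0.
- by rewrite /lie2_grading /= u0 mulr0.
- by rewrite /lie2_map /= mulr0 A0; exact: grading0.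
Qed.

Lemma endo_section_linear : linear NS.
Proof. by move=> a X Y; apply: section_ext => x /=; rewrite endoD endoZ. Qed.

Lemma endo_section2_linear : linear (NS \o NS).
Proof. by move=> a X Y; rewrite /= !endo_section_linear. Qed.

(** Vanishing torsion as a rewriting rule that removes products of two images of [N]. *)
Lemma torsion_free X Y :
  NS X ** NS Y = NS (NS X ** Y) + NS (X ** NS Y) - NS (NS (X ** Y)).
Proof.
have := hT X Y; rewrite /torsion => /eqP; rewrite subr_eq0 => /eqP ->.
by apply: section_ext => x; rewrite /deformed /= -scaleN1r !endoD endoZ scaleN1r.
Qed.

Let DN := derivation (lie2_map lam NS).
Let DK := derivation (lie2_map gam (NS \o NS)).

(** Casimir factors pass through [calD], so on a function f the sides are (lam - N)^2 Df and (gam -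
    N^2) Df, equal by the quadratic relation for N. *)
Lemma derivation_l1 u : DN (DN (lie2_structure C)) [:: u] =
  DK (lie2_structure C) [:: u].
Proof.
rewrite /DN /DK !derivation1E; apply: injective_projections.
  apply: smoothFun_ext => x.
  by suff : 0 - lam x * 0 - lam x * (0 - lam x * 0) = 0 - gam x * 0 by []; ring.
rewrite /= !calD_casimir//.
apply: section_ext => x; apply: (inner_inj (C := C)) => w /=.
rewrite !(endoD, endoN, endoZ, innerD, innerN, innerZ) inner_endo2.
by field.
Qed.

(** The function component follows from the Casimir rule for the anchor, the section component from
    vanishing torsion. *)
Lemma derivation_l2 u v : DN (DN (lie2_structure C)) [:: u; v] =
  DK (lie2_structure C) [:: u; v].
Proof.
pose phi := lie2_map lam NS; pose kappa := lie2_map gam (NS \o NS).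
rewrite /DN /DK !derivation2E; apply: injective_projections.
  apply: smoothFun_ext => x.
  pose F (u v : V) : R := 2^-1 * ip u.2 (calD C v.1) x + 2^-1 * ip v.2 (calD C u.1) x.
  suff : F (phi (phi u)) v + F (phi u) (phi v) - lam x * F (phi u) v +
      (F (phi u) (phi v) + F u (phi (phi v)) - lam x * F u (phi v)) -
      lam x * (F (phi u) v + F u (phi v) - lam x * F u v) =
      F (kappa u) v + F u (kappa v) - gam x * F u v by [].
  rewrite /F !ip_calD /= !anchor_casimir//.
  ring.
pose B (X Y : section E) : section E := 2^-1 *: (X ** Y - Y ** X).
suff : B (NS (NS u.2)) v.2 + B (NS u.2) (NS v.2) - NS (B (NS u.2) v.2) +
    (B (NS u.2) (NS v.2) + B u.2 (NS (NS v.2)) - NS (B u.2 (NS v.2))) -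
    NS (B (NS u.2) v.2 + B u.2 (NS v.2) - NS (B u.2 v.2)) =
    B (NS (NS u.2)) v.2 + B u.2 (NS (NS v.2)) - NS (NS (B u.2 v.2)) by [].
apply: section_ext => x; apply: (inner_inj (C := C)) => w.
rewrite /B !torsion_free /=.
rewrite !(endoD, endoN, endoZ, innerD, innerN, innerZ).
ring.
Qed.

(* The part of [D_N (D_N l3) - D_K l3] contributed by one of the three cyclic terms. *)
Lemma skew_pairing_endo x X Y Z :
  2 * skew_pairing C x (NS X) (NS Y) Z + 2 * skew_pairing C x (NS X) Y (NS Z) +
  2 * skew_pairing C x X (NS Y) (NS Z) =
  2 * lam x * (skew_pairing C x (NS X) Y Z + skew_pairing C x X (NS Y) Z +
    skew_pairing C x X Y (NS Z)) - (lam x ^+ 2 + gam x) * skew_pairing C x X Y Z.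
Proof.
(* Takes [N] out of the last slot, so that it acts only on Dorfman products and their factors. *)
have adj W : ip W (NS Z) x = lam x * ip W Z x - ip (NS W) Z x.
  by rewrite /= inner_endo; ring.
rewrite /skew_pairing !adj !torsion_free /=.
rewrite !(endoD, endoN, endoZ, innerD, innerN, innerZ) !inner_endo2.
by field.
Qed.

Lemma derivation_l3 u v w : DN (DN (lie2_structure C)) [:: u; v; w] =
  DK (lie2_structure C) [:: u; v; w].
Proof.
rewrite /DN /DK !derivation3E; apply: injective_projections; last first.
  apply: section_ext => x; apply: (inner_inj (C := C)) => z /=.
  by rewrite !(endoD, endoN, endoZ, innerD, innerN, innerZ) !inner_endo2 !inner_endo !inner0; field.
apply: smoothFun_ext => x.
pose F := cyclic_pairing C.
pose X := u.2; pose Y := v.2; pose Z := w.2.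
suff : F (NS (NS X)) Y Z x + F (NS X) (NS Y) Z x + F (NS X) Y (NS Z) x -
      lam x * F (NS X) Y Z x +
    (F (NS X) (NS Y) Z x + F X (NS (NS Y)) Z x + F X (NS Y) (NS Z) x -
      lam x * F X (NS Y) Z x) +
    (F (NS X) Y (NS Z) x + F X (NS Y) (NS Z) x + F X Y (NS (NS Z)) x -
      lam x * F X Y (NS Z) x) -
    lam x * (F (NS X) Y Z x + F X (NS Y) Z x + F X Y (NS Z) x - lam x * F X Y Z x) =
    F (NS (NS X)) Y Z x + F X (NS (NS Y)) Z x + F X Y (NS (NS Z)) x -
    gam x * F X Y Z x by [].
clearbody X Y Z; clear u v w.
(* The terms with N^2 on one argument cancel between the sides; the rest is 1/12 of the sum of these
   three identities. *)
have h1 := skew_pairing_endo x X Y Z.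
have h2 := skew_pairing_endo x Y Z X.
have h3 := skew_pairing_endo x Z X Y.
rewrite /F !cyclic_pairingE.
lra.
Qed.

End NijenhuisTensor.

(** * The Nijenhuis condition, assembled arity by arity *)

Theorem proposition5p14 (R : realType) (n : nat) (M : manifold R n)
  (E : vectorBundle M) (C : courantAlgebroid E) (N : bundleEndo E)
  (lam gam : smoothFun M)
  (hT : forall X Y : section E, torsion C N X Y = 0)
  (hlam : casimir C lam) (hgam : casimir C gam)
  (hN : forall (X : section E) (x : M),
     endo N x (X x) + transpose C (endo N) (X x) = lam x *: X x)
  (hN2 : forall (X : section E) (x : M),
     endo N x (endo N x (X x)) +
     transpose C (fun y e => endo N y (endo N y e)) (X x) = gam x *: X x) :
  let calN : lie2_space E -> lie2_space E :=
    fun u => (lam * u.1, endo_section N u.2) in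
  let calK : lie2_space E -> lie2_space E :=
    fun u => (gam * u.1, endo_section N (endo_section N u.2)) in
  (forall X : section E,
     endo_section N (endo_section N X) =
     fscale lam (endo_section N X) + fscale (2^-1 *: (gam - lam ^+ 2)) X) /\
  nijenhuis_with_square (@lie2_grading R n M E) (lie2_structure C)
    (one_form calN) (one_form calK).
Proof.
move=> calN calK; split; first exact: endo2E.
have mu_form := lie2_structure_form C.
have mu0 := form_of_degree_vanishing mu_form.
have [_ mu_sym _] := mu_form.
have linN : linear calN by exact: (lie2_map_linear lam (endo_section_linear N)).
have linK : linear calK by exact: (lie2_map_linear gam (endo_section2_linear N)).
have degN : forall i u, lie2_grading i u -> lie2_grading i (calN u).
  exact: (lie2_map_degree lam (endo_section_linear N)).
have degK : forall i u, lie2_grading i u -> lie2_grading i (calK u).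
  exact: (lie2_map_degree gam (endo_section2_linear N)).
have lin0 (phi : lie2_space E -> lie2_space E) : linear phi -> phi 0 = 0.
  by move=> lphi; have := lphi (-1) 0 0; rewrite scaler0 addr0 scaleN1r addNr.
have linZ (phi : lie2_space E -> lie2_space E) : linear phi ->
    forall a u, phi (a *: u) = a *: phi u.
  by move=> lphi a u; have := lphi a u 0; rewrite !addr0 lin0// addr0.
have G0 : forall i, @lie2_grading R n M E i 0 by exact: grading0.
have hom0 : homogeneous (@lie2_grading R n M E) 0 by exists 0.
have formK := one_form_degree0 G0 linK degK.
split=> //; first exact: one_form_degree0.
- move=> s hs; rewrite (bracketRN_one_form2 (linZ _ linN) degN hom0 mu0 mu_sym hs).
  rewrite (bracketRN_one_form degK _ mu0 mu_sym hs).
  (* The structure has components only in one, two and three arguments, so both sides vanish in all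
     other lengths. *)
  have vanish r : (size r == 0) || (3 < size r)%N ->
      derivation calN (derivation calN (lie2_structure C)) r =
      derivation calK (lie2_structure C) r.
    have mu_vanish t : (size t == 0) || (3 < size t)%N -> lie2_structure C t = 0.
      by case: t => [|? [|? [|? [|? ?]]]].
    move=> r_size; rewrite [RHS]derivation_eq0 ?(lin0 _ linK)//; last first.
      by move=> t tr; rewrite mu_vanish// tr.
    apply: derivation_eq0 => [|t tr]; first exact: lin0.
    apply: derivation_eq0 => [|t' t'r]; first exact: lin0.
    by rewrite mu_vanish// t'r tr.
  case: s hs => [|u [|v [|w [|t s]]]] _; [exact: vanish| | | |exact: vanish].
  + exact: derivation_l1.
  + exact: derivation_l2.
  + exact: derivation_l3.
- move=> s hs.
  have [_ symK _] := formK.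
  rewrite (bracketRN_one_form degN _ (form_of_degree_vanishing formK) symK hs).
  case: s hs => [|u [|v s]] _.
  + by apply: derivation_eq0; [exact: lin0|case].
  (* On one argument the bracket is the commutator of [calN] and [calK]: on sections both composites
     are N^3 by computation, on functions lam and gam commute. *)
  + rewrite derivation1E; apply: injective_projections; last exact: subrr.
    apply: smoothFun_ext => x.
    by suff : gam x * (lam x * u.1 x) - lam x * (gam x * u.1 x) = 0 by []; ring.
  + by apply: derivation_eq0; [exact: lin0|case=> [|? []]].
Qed.
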